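(* Let $\mathcal{P}\subset\mathbb{R}^d$ be a $d$-dimensional simple polytope all of whose edges have rational directions. For each vertex $\mathbf{v}$ of $\mathcal{P}$ choose a vector $\xi_{\mathbf{v}}\in\mathbb{R}^d$ that is not perpendicular to any edge direction of $\mathcal{P}$ at $\mathbf{v}$ (the vectors $\xi_{\mathbf{v}}$ may be chosen independently at different vertices). Then, as an identity of rational functions in $\mathbb{C}(x_1,\dots,x_d)$, $$\sigma_{\mathcal{P}}(x)\ =\ \sum_{\mathbf{v}\text{ a vertex of }\mathcal{P}} (-1)^{|E^-_{\mathbf{v}}(\xi_{\mathbf{v}})|}\,\sigma_{\mathcal{K}_{\xi_{\mathbf{v}},\mathbf{v}}}(x).$$
   Context: For $\mathbf{m}=(m_1,\dots,m_d)\in\mathbb{Z}^d$ write $x^{\mathbf{m}}=x_1^{m_1}\cdots x_d^{m_d}$. For the polytope $\mathcal{P}$, $\sigma_{\mathcal{P}}(x)=\sum_{\mathbf{m}\in\mathcal{P}\cap\mathbb{Z}^d}x^{\mathbf{m}}$, a Laurent polynomial. A $d$-dimensional polytope is simple if every vertex lies on exactly $d$ edges. The edge directions at a vertex $\mathbf{v}$ are the vectors pointing from $\mathbf{v}$ along the $d$ edges containing $\mathbf{v}$; since the edges have rational directions, each edge direction is represented by a nonzero integer vector $\mathbf{w}\in\mathbb{Z}^d$, and the $d$ edge directions at $\mathbf{v}$ are linearly independent. The vertices themselves are not required to be rational. For $\xi\in\mathbb{R}^d$ not perpendicular to any edge direction at $\mathbf{v}$, let $E^+_{\mathbf{v}}(\xi)$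 be the set of edge directions $\mathbf{w}$ at $\mathbf{v}$ with $\mathbf{w}\cdot\xi>0$ and $E^-_{\mathbf{v}}(\xi)$ the set of those with $\mathbf{w}\cdot\xi<0$. Define the (in general half-open) cone $$\mathcal{K}_{\xi,\mathbf{v}}=\mathbf{v}+\sum_{\mathbf{w}\in E^+_{\mathbf{v}}(\xi)}\mathbb{R}_{\ge 0}\,\mathbf{w}+\sum_{\mathbf{w}\in E^-_{\mathbf{v}}(\xi)}\mathbb{R}_{<0}\,\mathbf{w}.$$ $\sigma_{\mathcal{K}_{\xi,\mathbf{v}}}(x)\in\mathbb{C}(x_1,\dots,x_d)$ denotes the rational function represented by the generating series $S=\sum_{\mathbf{m}\in\mathcal{K}_{\xi,\mathbf{v}}\cap\mathbb{Z}^d}x^{\mathbf{m}}$. That is, if $\mathbf{w}_1,\dots,\mathbf{w}_d\in\mathbb{Z}^d$ are the edge directions at $\mathbf{v}$, then $g=\prod_{i=1}^d(1-x^{\mathbf{w}_i})$ is a nonzero Laurent polynomial for which the product $gS$ of formal Laurent series is a Laurent polynomial $f$, and $\sigma_{\mathcal{K}_{\xi,\mathbf{v}}}=f/g$ (independent of the choice of such a $g$). *)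

(* Defs.v *)
From HB Require Import structures.
From mathcomp Require Import all_boot all_order all_algebra.
From mathcomp Require Import fraction complex finmap.
From mathcomp Require Import boolp classical_sets functions cardinality.
From mathcomp Require Import fsbigop reals.
From mathcomp Require Import mpoly.

Set Implicit Arguments.
Unset Strict Implicit.
Unset Printing Implicit Defensive.

Import Order.TTheory GRing.Theory Num.Theory.

Local Open Scope classical_set_scope.
Local Open Scope ring_scope.

Section Polytopes.
Context {R : realType} {d : nat}.
Implicit Types (P F : set 'rV[R]_d) (u v x : 'rV[R]_d).

Definition dot u v : R := \sum_(i < d) u 0 i * v 0 i.

Definition toR (m : 'rV[int]_d) : 'rV[R]_d := map_mx intr m.

Definition conv_hull (A : set 'rV[R]_d) : set 'rV[R]_d :=
  [set x | exists (n : nat) (p : 'I_n -> 'rV[R]_d) (a : 'I_n -> R),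
    [/\ forall i, A (p i), forall i, 0 <= a i, \sum_i a i = 1
      & x = \sum_i a i *: p i]].

Definition aff_hull (A : set 'rV[R]_d) : set 'rV[R]_d :=
  [set x | exists (n : nat) (p : 'I_n -> 'rV[R]_d) (a : 'I_n -> R),
    [/\ forall i, A (p i), \sum_i a i = 1 & x = \sum_i a i *: p i]].

Definition has_dim (A : set 'rV[R]_d) (k : nat) : Prop :=
  exists (x0 : 'rV[R]_d) (U : {vspace 'rV[R]_d}),
    \dim U = k /\ aff_hull A = [set x | x - x0 \in U].

Definition is_polytope P : Prop :=
  exists2 V : set 'rV[R]_d, finite_set V & P = conv_hull V.

Definition is_face P F : Prop :=
  exists (c : 'rV[R]_d) (b : R),
    (forall x, P x -> dot c x <= b) /\ F = P `&` [set x | dot c x = b].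

Definition is_vertex P v : Prop := is_face P [set v].

Definition is_edge P F : Prop := is_face P F /\ has_dim F 1.

Definition edges_at P v : set (set 'rV[R]_d) :=
  [set F | is_edge P F /\ F v].

Definition is_simple P : Prop :=
  forall v, is_vertex P v -> (edges_at P v #= `I_d)%card.

Definition rational_direction F : Prop :=
  exists2 w : 'rV[int]_d, w != 0 &
    forall x y, F x -> F y -> exists t : R, y - x = t *: toR w.

Definition directs_edge v F (w : 'rV[int]_d) : Prop :=
  w != 0 /\ exists2 t : R, 0 < t & F (v + t *: toR w).

(* An edge direction is only determined up to a positive factor; [w] lists one
   integer representative for each edge at [v]. *)
Definition edge_directions P v (w : 'I_d -> 'rV[int]_d) : Prop :=
  exists2 F : 'I_d -> set 'rV[R]_d,
    set_bij [set: 'I_d] (edges_at P v) F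
    & forall i, directs_edge v (F i) (w i).

Definition Eplus (w : 'I_d -> 'rV[int]_d) (xi : 'rV[R]_d) : {set 'I_d} :=
  [set i | 0 < dot (toR (w i)) xi]%SET.

Definition Eminus (w : 'I_d -> 'rV[int]_d) (xi : 'rV[R]_d) : {set 'I_d} :=
  [set i | dot (toR (w i)) xi < 0]%SET.

Definition half_open_cone (w : 'I_d -> 'rV[int]_d) (xi v : 'rV[R]_d) :
    set 'rV[R]_d :=
  [set x | exists a : 'I_d -> R,
    [/\ forall i, i \in Eplus w xi -> 0 <= a i,
        forall i, i \in Eminus w xi -> a i < 0
      & x = v + \sum_(i in Eplus w xi) a i *: toR (w i)
              + \sum_(i in Eminus w xi) a i *: toR (w i)]].

End Polytopes.

Section GeneratingFunctions.
Context {C : fieldType} {d : nat}.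

Definition ratfun := {fraction {mpoly C[d]}}.

Definition xmon (m : 'rV[int]_d) : ratfun :=
  \prod_(i < d) (tofrac ('X_i : {mpoly C[d]})) ^ (m 0 i).

(* A Laurent polynomial is a finitely supported coefficient family, a formal
   Laurent series an arbitrary one. *)
Definition laurent_poly := {fsfun 'rV[int]_d -> C with 0}.

Definition laurent_eval (p : laurent_poly) : ratfun :=
  \sum_(m <- finsupp p) tofrac (p m)%:MP * xmon m.

Definition laurent_mul (p : laurent_poly) (S : 'rV[int]_d -> C) :
    'rV[int]_d -> C :=
  fun n => \sum_(m <- finsupp p) p m * S (n - m).

Definition represents (S : 'rV[int]_d -> C) (r : ratfun) : Prop :=
  exists g f : laurent_poly,
    [/\ exists m, g m != 0, laurent_mul g S = (f : 'rV[int]_d -> C)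
      & r = laurent_eval f / laurent_eval g].

(* The value is 0 when [S] represents no rational function; otherwise it is the
   only one, since [g * S = f] and [g' * S = f'] give [g' * f = g * f']. *)
Definition ratfun_of_series (S : 'rV[int]_d -> C) : ratfun :=
  xget 0 [set r | represents S r].

End GeneratingFunctions.

Arguments ratfun : clear implicits.
Arguments laurent_poly : clear implicits.

Section LatticePoints.
Context {R : realType} {d : nat}.

Definition lattice_points (A : set 'rV[R]_d) : set 'rV[int]_d :=
  [set m | A (toR m)].

Definition lattice_series (A : set 'rV[R]_d) : 'rV[int]_d -> R[i] :=
  fun m => (m \in lattice_points A)%:R.

(* Meant for [A] with finitely many lattice points: the sum over an infinite
   support is 0 by convention. *)
Definition sigma_polytope (A : set 'rV[R]_d) : ratfun R[i] d :=
  \sum_(m \in lattice_points A) xmon (C := R[i]) m.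

Definition sigma_cone (A : set 'rV[R]_d) : ratfun R[i] d :=
  ratfun_of_series (lattice_series A).

End LatticePoints.

(* Main.v *)
Require Import Defs.
From mathcomp Require Import all_boot all_order all_algebra.
From mathcomp Require Import fraction complex finmap.
From mathcomp Require Import boolp classical_sets functions cardinality.
From mathcomp Require Import fsbigop reals.
From mathcomp Require Import mpoly.
From mathcomp Require Import ring lra zify.

(* Modulo series annihilated by some [1 - x^w], replacing a generator of a
   half-open cone by its open opposite only changes the sign, because the two
   cones together are invariant under translation by [w]. Hence every term of the
   sum is independent of [xi], and one may use the same generic [xi0] at all
   vertices.

   For a common [xi0] the identity already holds for indicator functions. Fix [x]
   and let [xi] move from [xi0] along a segment to [xi1]: the signed count of the
   cones containing [x] can change only when [xi] becomes perpendicular to an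
   edge, and then the jumps at the two endpoints of that edge cancel, since the
   tangent cones at both endpoints agree modulo the direction of the edge. If [x]
   lies in the polytope, the count is 1, coming from the vertex minimizing [xi0];
   otherwise take for [xi1] a functional separating [x] from the polytope, for
   which no cone contains [x]. *)

Set Implicit Arguments.
Unset Strict Implicit.
Unset Printing Implicit Defensive.

Import Order.TTheory GRing.Theory Num.Theory.

Local Open Scope classical_set_scope.
Local Open Scope ring_scope.

(** * Rational functions of Laurent series *)

(** The encoding of edge directions asserts neither that they are independent nor that they generate
    the tangent cone. Generation is derived from [gordan], and independence then from full
    dimension. Since [gordan] is proved by induction on a finite list, no compactness argument is
    needed; it also yields the separating functional.

    Vertices may be irrational, but the generators [w i] are integral, and translation by them is
    all that the series argument uses.

    On an arbitrary segment several non-parallel edges could become perpendicular to [xi] at the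
    same time. The endpoint [xi1] is therefore perturbed until all chords killed at a common time
    are parallel. Then a vertex has at most one edge in the wall, and at most two vertices share a
    value of [xi], because no three vertices are collinear.

    All half-open cones at [v] carry one rational function [r v] up to sign. The signed sum is
    therefore the sum of the [r v] for every choice of [xi], and the indicator identity at [xi0]
    identifies that sum. *)

Section LaurentPolynomials.
Context {C : fieldType} {d : nat}.
Implicit Types (m n : 'rV[int]_d) (p g h : laurent_poly C d).
Implicit Types (S : 'rV[int]_d -> C) (r s : ratfun C d).

Definition lconst (c : C) : ratfun C d := tofrac (mpolyC d c).

Lemma lconstM : {morph lconst : a b / a * b}.
Proof. by move=> a b; rewrite /lconst mpolyCM tofracM. Qed.

Lemma lconstD : {morph lconst : a b / a + b}.
Proof. by move=> a b; rewrite /lconst mpolyCD tofracD. Qed.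

Lemma lconst0 : lconst 0 = 0.
Proof. by rewrite /lconst mpolyC0 tofrac0. Qed.

Lemma lconst1 : lconst 1 = 1.
Proof. by rewrite /lconst mpolyC1 tofrac1. Qed.

Lemma lconst_sum (I : Type) (e : seq I) (F : I -> C) :
  lconst (\sum_(i <- e) F i) = \sum_(i <- e) lconst (F i).
Proof. exact: (big_morph lconst lconstD lconst0). Qed.

Lemma tofracX_neq0 (i : 'I_d) : tofrac ('X_i : {mpoly C[d]}) != 0.
Proof.
rewrite tofrac_eq0; apply/eqP => /(congr1 (mcoeff U_(i)%MM)).
by rewrite mcoeffX eqxx mcoeff0 => /eqP; rewrite oner_eq0.
Qed.

Lemma xmonD m n : xmon (m + n) = xmon m * xmon n :> ratfun C d.
Proof.
rewrite /xmon -big_split /=; apply: eq_bigr => i _.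
by rewrite mxE expfzDr // tofracX_neq0.
Qed.

Lemma xmon0 : xmon 0 = 1 :> ratfun C d.
Proof. by rewrite /xmon big1 // => i _; rewrite mxE expr0z. Qed.

Lemma xmon_nneg m : (forall i, 0 <= m 0 i) ->
  xmon m = tofrac 'X_[[multinom absz (m 0%R i) | i < d]] :> ratfun C d.
Proof.
move=> m_ge0; rewrite mpolyXE_id rmorph_prod; apply: eq_bigr => i _ /=.
rewrite mnmE tofracXn; move: (m_ge0 i); case: (m 0 i) => // k _.
Qed.

Lemma laurent_evalE (D : {fset 'rV[int]_d}) p : (finsupp p `<=` D)%fset ->
  laurent_eval p = \sum_(m <- D) lconst (p m) * xmon m.
Proof.
move=> pD; rewrite /laurent_eval (big_fset_incl _ pD) // => m _.
by rewrite memNfinsupp => /eqP ->; rewrite -/(lconst 0) lconst0 mul0r.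
Qed.

Lemma laurent_mulE (D : {fset 'rV[int]_d}) p S n : (finsupp p `<=` D)%fset ->
  laurent_mul p S n = \sum_(m <- D) p m * S (n - m).
Proof.
move=> pD; rewrite /laurent_mul (big_fset_incl _ pD) // => m _.
by rewrite memNfinsupp => /eqP ->; rewrite mul0r.
Qed.

(** Serves both facts about [laurent_conv]: once the sums are exchanged, the inner sum runs over the
    support of the second factor translated by an exponent [m] of the first. *)
Lemma sum_finsupp_shift (V : nmodType) (D : {fset 'rV[int]_d}) p m
    (F : 'rV[int]_d -> V) :
    (forall n, n \in finsupp p -> n + m \in D) ->
    (forall n, n \notin finsupp p -> F n = 0) ->
  \sum_(n <- D) F (n - m) = \sum_(n <- finsupp p) F n.
Proof.
move=> pD F0; pose E := [fset (n + m)%R | n in finsupp p]%fset.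
have -> : \sum_(n <- finsupp p) F n = \sum_(n <- E) F (n - m).
  rewrite /E big_imfset /=; last by move=> ? ? _ _; apply: addIr.
  by apply: eq_bigr => n _; rewrite addrK.
rewrite -(big_fset_incl _ (A := E)) //.
  by apply/fsubsetP => _ /imfsetP[n /= np ->]; apply: pD.
move=> n _ nE; apply: F0; apply: contra nE => nm.
by apply/imfsetP; exists (n - m) => //=; rewrite subrK.
Qed.

Definition laurent_conv g h : laurent_poly C d :=
  [fsfun n in [fset (a + b)%R | a in finsupp g, b in finsupp h]%fset
     => laurent_mul g h n].

Lemma laurent_convE g h n : laurent_conv g h n = laurent_mul g h n.
Proof.
rewrite /laurent_conv fsfunE; case: ifPn => // nD; rewrite /laurent_mul.
rewrite big_seq big1 // => m mg; have [nh|] := boolP (n - m \in finsupp h).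
  by case/imfset2P: nD; exists m => //; exists (n - m) => //; rewrite addrC subrK.
by rewrite memNfinsupp => /eqP ->; rewrite mulr0.
Qed.

(** Coefficients of a product may cancel, so only a finite set containing its support is kept. *)
Lemma finsupp_laurent_conv g h : exists2 D : {fset 'rV[int]_d},
  (finsupp (laurent_conv g h) `<=` D)%fset &
  forall a b, a \in finsupp g -> b \in finsupp h -> b + a \in D.
Proof.
exists [fset (a + b)%R | a in finsupp g, b in finsupp h]%fset.
  apply/fsubsetP => n; apply: contraLR => nD.
  by rewrite memNfinsupp /laurent_conv fsfunE (negbTE nD).
by move=> a b ag bh; rewrite addrC; apply: in_imfset2.
Qed.

Lemma laurent_mulA g h S :
  laurent_mul (laurent_conv g h) S = laurent_mul g (laurent_mul h S).
Proof.
apply/funext => n; have [D subD inD] := finsupp_laurent_conv g h.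
rewrite (laurent_mulE _ _ subD).
under eq_bigr do rewrite laurent_convE /laurent_mul mulr_suml.
rewrite exchange_big /= /laurent_mul big_seq [RHS]big_seq.
apply: eq_bigr => m mg; rewrite mulr_sumr.
rewrite -(sum_finsupp_shift (D := D) (m := m)); first last.
- by move=> k; rewrite memNfinsupp => /eqP ->; rewrite mul0r mulr0.
- by move=> k kh; apply: inD.
by apply: eq_bigr => k _; rewrite mulrA opprB [k - m]addrC addrA subrK.
Qed.

Lemma laurent_eval_conv g h :
  laurent_eval (laurent_conv g h) = laurent_eval g * laurent_eval h.
Proof.
have [D subD inD] := finsupp_laurent_conv g h.
rewrite (laurent_evalE subD).
under eq_bigr do rewrite laurent_convE /laurent_mul lconst_sum mulr_suml.
rewrite exchange_big /= /laurent_eval mulr_suml big_seq [RHS]big_seq.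
apply: eq_bigr => m mg; rewrite mulr_sumr.
rewrite -(sum_finsupp_shift (D := D) (m := m)); first last.
- move=> k; rewrite memNfinsupp => /eqP ->.
  by rewrite -/(lconst 0) lconst0 mul0r mulr0.
- by move=> k kh; apply: inD.
apply: eq_bigr => k _; rewrite lconstM -!/(lconst _).
have -> : xmon k = xmon (k - m) * xmon m :> ratfun C d by rewrite -xmonD subrK.
by rewrite [xmon (k - m) * _]mulrC mulrACA.
Qed.

Lemma laurent_conv_comm g h n : laurent_conv g h n = laurent_conv h g n.
Proof.
rewrite !laurent_convE /laurent_mul.
pose D := ([fset (n - m)%R | m in finsupp g] `|` finsupp h)%fset.
pose G m := h m * g (n - m).
rewrite [RHS](big_fset_incl _ (B := D)) ?fsubsetUr //; last first.
  by move=> m _; rewrite memNfinsupp => /eqP ->; rewrite mul0r.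
rewrite -(big_fset_incl _ (A := [fset (n - m)%R | m in finsupp g]%fset)).
- rewrite big_imfset /=; last by move=> ? ? _ _ /addrI /oppr_inj.
  by apply: eq_bigr => m _; rewrite subKr mulrC.
- exact: fsubsetUl.
move=> m _ mg; have -> : g (n - m) = 0; last by rewrite mulr0.
apply/eqP; rewrite -[_ == 0]memNfinsupp; apply: contra mg => mg.
by apply/imfsetP; exists (n - m) => //=; rewrite subKr.
Qed.

Lemma laurent_mulCA g h S :
  laurent_mul g (laurent_mul h S) = laurent_mul h (laurent_mul g S).
Proof.
rewrite -!laurent_mulA; congr laurent_mul.
by apply/fsfunP => n; apply: laurent_conv_comm.
Qed.

(** Multiplying by a monomial with all exponents equal to a large [N] turns [g] into an ordinary
    polynomial [q]. Distinct exponents stay distinct, so [g m] survives as a coefficient of [q]. *)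
Lemma laurent_eval_neq0 g m : g m != 0 -> laurent_eval g != 0.
Proof.
move=> gm.
have [N N_max] : exists N : nat, forall n i, n \in finsupp g ->
    (0 <= (n + const_mx N%:Z) 0 i)%R.
  exists (\sum_(n <- finsupp g) \sum_(i < d) absz (n 0%R i))%N => n i ng.
  rewrite !mxE (big_fsetD1 n) //= (bigD1 i) //=.
  set a := bigop _ _ _; set b := bigop _ _ _.
  by move: (n 0 i) a b => x a b; lia.
pose e n : 'X_{1..d} := [multinom absz ((n + const_mx N%:Z)%R 0%R i) | i < d].
have e_inj n n' : n \in finsupp g -> n' \in finsupp g -> e n = e n' -> n = n'.
  move=> ng n'g /mnmP en; apply/rowP => i; have := en i; rewrite !mnmE.
  have := N_max _ i ng; have := N_max _ i n'g.
  by rewrite !mxE; move: (n 0 i) (n' 0 i) => x y; lia.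
pose q : {mpoly C[d]} := \sum_(n <- finsupp g) (g n)%:MP * 'X_[e n].
have eval_q : laurent_eval g * xmon (const_mx N%:Z) = tofrac q.
  rewrite /laurent_eval mulr_suml rmorph_sum /= big_seq [RHS]big_seq.
  apply: eq_bigr => n ng; rewrite -mulrA -xmonD xmon_nneg ?tofracM //.
  by move=> i; apply: N_max.
apply/eqP => g0; move: eval_q; rewrite g0 mul0r => /esym/eqP.
rewrite tofrac_eq0 => /eqP/(congr1 (mcoeff (e m))).
have mg : m \in finsupp g by rewrite mem_finsupp.
rewrite mcoeff0 /q (big_fsetD1 m) //= mcoeffD mcoeffCM mcoeffX eqxx mulr1.
rewrite raddf_sum big_seq big1 ?addr0; first by move/eqP; rewrite (negbTE gm).
move=> n; rewrite in_fsetD1 => /andP[nm ng] /=.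
rewrite mcoeffCM mcoeffX; case: eqP => [/e_inj E|]; last by rewrite mulr0.
by rewrite E ?eqxx in nm.
Qed.

(** Laurent polynomials have no zero divisors because evaluation is multiplicative, takes values in
    a field and kills no nonzero one. *)
Lemma laurent_conv_neq0 g h : (exists m, g m != 0) -> (exists m, h m != 0) ->
  exists m, laurent_conv g h m != 0.
Proof.
move=> [a /laurent_eval_neq0 ga] [b /laurent_eval_neq0 hb].
apply: contrapT => /forallNP gh.
have /eqP := mulf_neq0 ga hb; apply; rewrite -laurent_eval_conv.
rewrite /laurent_eval big1 // => n _; have /negP := gh n; rewrite negbK.
by move=> /eqP ->; rewrite -/(lconst 0) lconst0 mul0r.
Qed.

Lemma represents_uniq S r s : represents S r -> represents S s -> r = s.
Proof.
move=> [g [f [[m gm] gS ->]]] [g' [f' [[m' gm'] gS' ->]]].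
apply/eqP; rewrite (eqr_div _ _ (laurent_eval_neq0 gm) (laurent_eval_neq0 gm')).
rewrite -!laurent_eval_conv; apply/eqP; congr laurent_eval; apply/fsfunP => n.
rewrite (laurent_conv_comm f) (laurent_conv_comm f') !laurent_convE.
by rewrite -gS -gS' laurent_mulCA.
Qed.

Lemma ratfun_of_seriesE S r : represents S r -> ratfun_of_series S = r.
Proof.
by move=> Sr; rewrite /ratfun_of_series; apply: xget_unique => // s /represents_uniq; apply.
Qed.

Lemma laurent_mulD g S S' n :
  laurent_mul g (fun k => S k + S' k) n = laurent_mul g S n + laurent_mul g S' n.
Proof. by rewrite -big_split; apply: eq_bigr => m _; rewrite mulrDr. Qed.

Lemma laurent_mulZ g c S n :
  laurent_mul g (fun k => c * S k) n = c * laurent_mul g S n.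
Proof. by rewrite /laurent_mul mulr_sumr; apply: eq_bigr => m _; rewrite mulrCA. Qed.

Definition laurent_add g h : laurent_poly C d :=
  [fsfun n in (finsupp g `|` finsupp h)%fset => g n + h n].

Lemma laurent_addE g h n : laurent_add g h n = g n + h n.
Proof.
rewrite fsfunE; case: ifPn => //; rewrite in_fsetU negb_or !memNfinsupp.
by move=> /andP[/eqP -> /eqP ->]; rewrite addr0.
Qed.

Lemma laurent_eval_add g h :
  laurent_eval (laurent_add g h) = laurent_eval g + laurent_eval h.
Proof.
pose D := (finsupp g `|` finsupp h)%fset.
have sub : (finsupp (laurent_add g h) `<=` D)%fset.
  apply/fsubsetP => n; apply: contraLR => nD.
  by rewrite memNfinsupp /laurent_add fsfunE (negbTE nD).
rewrite (laurent_evalE sub) (laurent_evalE (fsubsetUl _ (finsupp h))).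
rewrite (laurent_evalE (fsubsetUr (finsupp g) _)) -big_split.
by apply: eq_bigr => n _; rewrite laurent_addE lconstD mulrDl.
Qed.

Definition laurent_scale c g : laurent_poly C d :=
  [fsfun n in finsupp g => c * g n].

Lemma laurent_scaleE c g n : laurent_scale c g n = c * g n.
Proof.
rewrite fsfunE; case: ifPn => //; rewrite memNfinsupp => /eqP ->.
by rewrite mulr0.
Qed.

Lemma laurent_eval_scale c g :
  laurent_eval (laurent_scale c g) = lconst c * laurent_eval g.
Proof.
have sub : (finsupp (laurent_scale c g) `<=` finsupp g)%fset.
  apply/fsubsetP => n; apply: contraLR => nD.
  by rewrite memNfinsupp /laurent_scale fsfunE (negbTE nD).
rewrite (laurent_evalE sub) (laurent_evalE (fsubset_refl (finsupp g))) mulr_sumr.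
by apply: eq_bigr => n _; rewrite laurent_scaleE lconstM mulrA.
Qed.

Lemma representsD S S' r s : represents S r -> represents S' s ->
  represents (fun n => S n + S' n) (r + s).
Proof.
move=> [g [f [g0 gS ->]]] [g' [f' [g'0 gS' ->]]].
exists (laurent_conv g g').
exists (laurent_add (laurent_conv g' f) (laurent_conv g f')); split.
- exact: laurent_conv_neq0.
- apply/funext => n; rewrite laurent_mulD laurent_addE !laurent_convE -gS -gS'.
  by rewrite !laurent_mulA [in LHS]laurent_mulCA.
case: g0 => m /laurent_eval_neq0 g0; case: g'0 => m' /laurent_eval_neq0 g'0.
rewrite (addf_div _ _ g0 g'0) laurent_eval_add !laurent_eval_conv.
by rewrite (mulrC (laurent_eval g')) (mulrC (laurent_eval g) (laurent_eval f')).
Qed.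

Lemma representsZ c S r : represents S r ->
  represents (fun n => c * S n) (lconst c * r).
Proof.
move=> [g [f [g0 gS ->]]]; exists g, (laurent_scale c f); split=> //.
  by apply/funext => n; rewrite laurent_mulZ laurent_scaleE gS.
by rewrite laurent_eval_scale mulrA.
Qed.

Definition laurent_one : laurent_poly C d := [fsfun n in [fset 0]%fset => 1].

Lemma laurent_oneE n : laurent_one n = (n == 0)%:R.
Proof. by rewrite fsfunE in_fset1; case: eqP. Qed.

Lemma finsupp_laurent_one : finsupp laurent_one = [fset 0]%fset.
Proof.
apply/fsetP => n; rewrite mem_finsupp laurent_oneE in_fset1.
by case: (n == 0); rewrite /= ?oner_eq0 ?eqxx.
Qed.

Lemma laurent_mul1 S : laurent_mul laurent_one S = S.
Proof.
apply/funext => n; rewrite /laurent_mul finsupp_laurent_one big_seq_fset1.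
by rewrite laurent_oneE eqxx mul1r subr0.
Qed.

Lemma laurent_eval1 : laurent_eval laurent_one = 1.
Proof.
rewrite /laurent_eval finsupp_laurent_one big_seq_fset1.
by rewrite laurent_oneE eqxx -/(lconst 1) lconst1 xmon0 mulr1.
Qed.

Lemma represents_finite S (D : {fset 'rV[int]_d}) :
    (forall n, n \notin D -> S n = 0) ->
  represents S (\sum_(n <- D) lconst (S n) * xmon n).
Proof.
move=> S0; pose f : laurent_poly C d := [fsfun n in D => S n].
have fE n : f n = S n.
  by rewrite fsfunE; case: ifPn => // /S0.
exists laurent_one, f; split.
- by exists 0; rewrite laurent_oneE eqxx oner_eq0.
- by rewrite laurent_mul1; apply/funext => n; rewrite fE.
rewrite laurent_eval1 divr1 (laurent_evalE (D := D)).
  by apply: eq_bigr => n _; rewrite fE.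
apply/fsubsetP => n; apply: contraLR => nD.
by rewrite memNfinsupp fE S0.
Qed.

Lemma represents0 : represents (fun=> 0 : C) (0 : ratfun C d).
Proof.
have := @represents_finite (fun=> 0) fset0 (fun _ _ => erefl).
by rewrite big_seq_fset0.
Qed.

Lemma represents_sum (I : eqType) (e : seq I) (S : I -> 'rV[int]_d -> C)
    (r : I -> ratfun C d) :
    (forall i, i \in e -> represents (S i) (r i)) ->
  represents (fun n => \sum_(i <- e) S i n) (\sum_(i <- e) r i).
Proof.
elim: e => [|i e IHe] Sr.
  by rewrite big_nil; under [X in represents X]eq_fun do rewrite big_nil; apply: represents0.
rewrite big_cons; under [X in represents X]eq_fun do rewrite big_cons.
apply: representsD; first by apply: Sr; rewrite mem_head.
by apply: IHe => j je; apply: Sr; rewrite inE je orbT.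
Qed.

(** Used to move factors $1 - x^{w}$ into the denominator one at a time. *)
Lemma represents_divl g S r : (exists m, g m != 0) ->
  represents (laurent_mul g S) r -> represents S (r / laurent_eval g).
Proof.
move=> g0 [h [f [h0 hS ->]]]; exists (laurent_conv h g), f; split.
- exact: laurent_conv_neq0.
- by rewrite laurent_mulA.
by rewrite laurent_eval_conv invfM mulrA.
Qed.

(** The Laurent polynomial $1 - x^m$. It degenerates to 0 at [m = 0], whence the condition [m != 0]
    below. *)
Definition laurent_sub1 m : laurent_poly C d :=
  laurent_add laurent_one (laurent_scale (-1) [fsfun n in [fset m]%fset => 1]).

Lemma laurent_sub1E m n : laurent_sub1 m n = (n == 0)%:R - (n == m)%:R.
Proof.
rewrite laurent_addE laurent_oneE laurent_scaleE fsfunE in_fset1 mulN1r.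
by case: (n == m).
Qed.

Lemma laurent_sub1_neq0 m : m != 0 -> exists n, laurent_sub1 m n != 0.
Proof.
by move=> m0; exists 0; rewrite laurent_sub1E eqxx [0 == m]eq_sym (negbTE m0) subr0 oner_eq0.
Qed.

Lemma laurent_mul_sub1 m S n : m != 0 ->
  laurent_mul (laurent_sub1 m) S n = S n - S (n - m).
Proof.
move=> m0; rewrite (laurent_mulE (D := [fset 0; m]%fset)).
  rewrite big_fsetU1 /= ?in_fset1 1?eq_sym // big_seq_fset1 !laurent_sub1E !eqxx.
  by rewrite (negbTE m0) [0 == m]eq_sym (negbTE m0) subr0 mul1r subr0 sub0r mulN1r.
apply/fsubsetP => k; rewrite mem_finsupp laurent_sub1E in_fset2.
by case: (k == 0); case: (k == m); rewrite ?subrr ?eqxx.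
Qed.

(** Such a series is annihilated by $1 - x^m$, so it represents $0/(1 - x^m)$. The two-sided
    geometric series is the model case. *)
Lemma represents_periodic m S : m != 0 -> (forall n, S (n - m) = S n) ->
  represents S 0.
Proof.
move=> m0 Sm; rewrite -[0](mul0r (laurent_eval (laurent_sub1 m))^-1).
apply: represents_divl; first exact: laurent_sub1_neq0.
rewrite (_ : laurent_mul _ _ = fun=> 0); first exact: represents0.
by apply/funext => n; rewrite laurent_mul_sub1 // Sm subrr.
Qed.

End LaurentPolynomials.

(** * Cones and theorems of the alternative *)

Section Convexity.
Context {R : realType} {d : nat}.
Implicit Types (u v x y l xi : 'rV[R]_d) (A B : set 'rV[R]_d).

Lemma dotC u v : dot u v = dot v u.
Proof. by apply: eq_bigr => i _; rewrite mulrC. Qed.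

Lemma dotDr u v x : dot u (v + x) = dot u v + dot u x.
Proof. by rewrite -big_split; apply: eq_bigr => i _; rewrite mxE mulrDr. Qed.

Lemma dotZr u a v : dot u (a *: v) = a * dot u v.
Proof. by rewrite /dot mulr_sumr; apply: eq_bigr => i _; rewrite mxE mulrCA. Qed.

Lemma dot0r u : dot u 0 = 0.
Proof. by rewrite -(scale0r (0 : 'rV[R]_d)) dotZr mul0r. Qed.

Lemma dotNr u v : dot u (- v) = - dot u v.
Proof. by rewrite -scaleN1r dotZr mulN1r. Qed.

Lemma dotBr u v x : dot u (v - x) = dot u v - dot u x.
Proof. by rewrite dotDr dotNr. Qed.

Lemma dotDl u v x : dot (u + v) x = dot u x + dot v x.
Proof. by rewrite dotC dotDr !(dotC x). Qed.

Lemma dotZl a u v : dot (a *: u) v = a * dot u v.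
Proof. by rewrite dotC dotZr dotC. Qed.

Lemma dotNl u v : dot (- u) v = - dot u v.
Proof. by rewrite dotC dotNr dotC. Qed.

Lemma dotBl u v x : dot (u - v) x = dot u x - dot v x.
Proof. by rewrite dotDl dotNl. Qed.

Lemma dot_sumr (I : Type) (r : seq I) (Q : pred I) (F : I -> 'rV[R]_d) u :
  dot u (\sum_(i <- r | Q i) F i) = \sum_(i <- r | Q i) dot u (F i).
Proof. exact: (big_morph (dot u) (dotDr u) (dot0r u)). Qed.

Lemma dot_gt0 u : u != 0 -> 0 < dot u u.
Proof.
move=> u0; rewrite lt_neqAle eq_sym sumr_ge0 ?andbT => [|i _]; last exact: sqr_ge0.
apply: contra u0 => /eqP u0; apply/eqP/rowP => i; rewrite mxE.
have sq_ge0 j : true -> 0 <= u 0 j * u 0 j by rewrite -expr2 sqr_ge0.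
by have /eqP := psumr_eq0P sq_ge0 u0 (i := i) isT; rewrite mulf_eq0 orbb => /eqP.
Qed.

Definition dotE := (dotDl, dotDr, dotBl, dotBr, dotNl, dotNr, dotZl, dotZr).

(** The convex cone generated by [A], built one generator at a time so that facts about it follow by
    induction without indexed families. *)
Inductive cone A : 'rV[R]_d -> Prop :=
| cone0 : cone A 0
| coneD x a t : cone A x -> A a -> 0 <= t -> cone A (x + t *: a).

Lemma cone_mem A a : A a -> cone A a.
Proof. by move=> Aa; rewrite -[a]scale1r -[_ *: a]add0r; apply: coneD => //; apply: cone0. Qed.

Lemma cone_add A x y : cone A x -> cone A y -> cone A (x + y).
Proof.
move=> Ax; elim=> [|{}y a t _ IH Aa t0]; first by rewrite addr0.
by rewrite addrA; apply: coneD.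
Qed.

Lemma cone_scale A t x : 0 <= t -> cone A x -> cone A (t *: x).
Proof.
move=> t0; elim=> [|{}x a s _ IH Aa s0]; first by rewrite scaler0; apply: cone0.
by rewrite scalerDr scalerA; apply: coneD => //; apply: mulr_ge0.
Qed.

Lemma cone_sum A (I : Type) (r : seq I) (F : I -> 'rV[R]_d) :
  (forall i, cone A (F i)) -> cone A (\sum_(i <- r) F i).
Proof.
move=> AF; elim: r => [|i r IHr]; first by rewrite big_nil; apply: cone0.
by rewrite big_cons; apply: cone_add.
Qed.

Lemma cone_trans A B x : (forall a, A a -> cone B a) -> cone A x -> cone B x.
Proof.
move=> AB; elim=> [|{}x a t _ IH Aa t0]; first exact: cone0.
by apply: cone_add => //; apply: cone_scale => //; apply: AB.
Qed.

Lemma cone_sub A B x : A `<=` B -> cone A x -> cone B x.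
Proof. by move=> AB; apply: cone_trans => a /AB; apply: cone_mem. Qed.

Lemma cone_dot_ge0 A l x : (forall a, A a -> 0 <= dot l a) -> cone A x ->
  0 <= dot l x.
Proof.
move=> lA; elim=> [|{}x a t _ IH Aa t0]; first by rewrite dot0r.
by rewrite !dotE addr_ge0 // mulr_ge0 //; apply: lA.
Qed.

(** A pair holds a positive value and the slope at which a perturbation changes it. This replaces
    the openness of finitely many strict inequalities. *)
Lemma small_perturbation (s : seq (R * R)) : (forall q, q \in s -> 0 < q.1) ->
  exists2 e : R, 0 < e & forall q, q \in s -> 0 < q.1 + e * q.2.
Proof.
elim: s => [|[a b] s IHs] s_gt0; first by exists 1.
have [q qs|e e0 He] := IHs; first by apply: s_gt0; rewrite inE qs orbT.
have a0 : 0 < a by apply: (s_gt0 (a, b)); rewrite inE eqxx.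
(* The 1 keeps the denominator positive and makes [e'] times the absolute value of [b] strictly less
   than [a]. *)
pose e' := Num.min e (a / (1 + `|b|)).
have den : 0 < 1 + `|b| by rewrite ltr_wpDr.
have e'0 : 0 < e' by rewrite lt_min e0 divr_gt0.
have small c f : 0 < c -> 0 < c + e * f -> 0 < c + e' * f.
  have : e' <= e by rewrite ge_min lexx.
  move: (e') e'0 => {}e' e'0 e'e c0 cef; have [f0|f0] := leP 0 f; first by nra.
  by nra.
exists e' => // q; rewrite inE => /orP[/eqP -> /=|qs]; last first.
  by apply: small; [apply: s_gt0; rewrite inE qs orbT|apply: He].
have e'a : e' * (1 + `|b|) <= a by rewrite -ler_pdivlMr // ge_min lexx orbT.
have : - `|b| <= b by rewrite lerNl ler_normr lexx orbT.
by move: (`|b|) (normr_ge0 b) e'a => c c0 e'a cb; nra.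
Qed.

(** Induction by elimination of [h0]. If the functional [l] found for the tail is negative on [h0],
    the tail is slid along [h0] into the kernel of [l], and the alternative for the slid vectors is
    transferred back. *)
Lemma gordan (s : seq 'rV[R]_d) :
  (exists l, forall h, h \in s -> 0 < dot l h) \/
  (exists2 h, h \in s & cone [set` s] (- h)).
Proof.
have [n] := ubnP (size s); elim: n s => // n IHn [|h0 s] /=; first by left; exists 0.
rewrite ltnS => sn.
have sub_s : [set` s] `<=` [set` h0 :: s] by move=> h; rewrite /= inE => ->; rewrite orbT.
have [[l ls]|[h hs hc]] := IHn s sn; last first.
  by right; exists h; [rewrite inE hs orbT|apply: cone_sub hc].
have perturb l1 v : (forall h, h \in s -> 0 < dot l1 h) -> dot l1 h0 = 0 ->
    0 < dot v h0 -> exists l, forall h, h \in h0 :: s -> 0 < dot l h.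
  move=> l1s l1h0 vh0.
  have [|e e0 He] := @small_perturbation [seq (dot l1 h, dot v h) | h <- s].
    by move=> q /mapP[h hs ->]; apply: l1s.
  exists (l1 + e *: v) => h; rewrite inE !dotE => /orP[/eqP ->|hs].
    by rewrite l1h0 add0r mulr_gt0.
  by apply: (He (_, _)); apply: map_f.
have [lh0|lh0|lh0] := ltgtP (dot l h0) 0; last first.
- have [->|h00] := eqVneq h0 0.
    by right; exists 0; rewrite ?inE ?eqxx // oppr0; apply: cone0.
  by left; apply: (perturb l h0) => //; apply: dot_gt0.
- by left; exists l => h; rewrite inE => /orP[/eqP ->|/ls].
(* The amount by which [h] is slid to reach the kernel of [l]. It is positive on the tail, so slid
   vectors stay in the cone of [h0 :: s]. *)
pose c h := dot l h / - dot l h0.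
have c_gt0 h : h \in s -> 0 < c h by move=> /ls ?; rewrite divr_gt0 // oppr_gt0.
have lc h : dot l h + c h * dot l h0 = 0.
  by rewrite /c invrN mulrN mulNr divfK ?subrr // lt_eqF.
have [|[l' l's]|[_ /mapP[h hs ->] hc]] := IHn [seq h + c h *: h0 | h <- s].
- by rewrite size_map.
(* With this [b], the functional [l' + b *: l] vanishes on [h0] and takes on [h] the value of [l']
   at the slid vector. Tilting it towards [- l] makes it positive on [h0] too. *)
- left; pose b := - dot l' h0 / dot l h0.
  have b0 : dot l' h0 + b * dot l h0 = 0.
    by rewrite /b divfK ?subrr // lt_eqF.
  apply: (perturb (l' + b *: l) (- l)).
  + move=> h hs; have := l's _ (map_f _ hs); rewrite !dotE; have := lc h; nra.
  + by rewrite !dotE.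
  + by rewrite !dotE oppr_gt0.
right; exists h; first by rewrite inE hs orbT.
have -> : - h = - (h + c h *: h0) + c h *: h0 by rewrite opprD addrNK.
apply: coneD; rewrite /= ?inE ?eqxx //; last exact/ltW/c_gt0.
apply: cone_trans hc => _ /mapP[k ks ->]; apply: coneD.
- by apply: cone_mem => /=; rewrite inE ks orbT.
- by rewrite /= inE eqxx.
- exact/ltW/c_gt0.
Qed.

(** A vector [u] killed by the current functional is repaired by adding a small multiple of [u]
    itself, since [dot u u] is positive. *)
Lemma generic_functional (s t : seq 'rV[R]_d) l :
    (forall q, q \in s -> 0 < dot l q) ->
  exists2 l', (forall q, q \in s -> 0 < dot l' q) &
    forall u, u \in t -> u != 0 -> dot l' u != 0.
Proof.
move=> ls; elim: t => [|u t [l' l's l't]]; first by exists l.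
have [->|u0] := eqVneq u 0.
  by exists l' => // v; rewrite inE => /orP[/eqP ->|/l't//]; rewrite eqxx.
have [l'u|l'u] := eqVneq (dot l' u) 0; last first.
  by exists l' => // v; rewrite inE => /orP[/eqP ->|/l't].
pose e1 := [seq (dot l' q, dot u q) | q <- s].
(* These pairs preserve the inequations already achieved: the change caused by [u] stays smaller
   than the present absolute value. *)
pose e2 := [seq (`|dot l' v|, - `|dot u v|) | v <- t & v != 0].
have [|e e0 He] := @small_perturbation (e1 ++ e2).
  move=> q; rewrite mem_cat => /orP[] /mapP[v].
    by move=> vs ->; apply: l's.
  by rewrite mem_filter => /andP[v0 vt] ->; rewrite normr_gt0 l't.
exists (l' + e *: u) => [q qs|v].
  by rewrite !dotE; apply: (He (_, _)); rewrite mem_cat map_f.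
rewrite inE !dotE => /orP[/eqP -> _|vt v0].
  by rewrite l'u add0r mulf_neq0 ?gt_eqF // dot_gt0.
have : 0 < `|dot l' v| + e * - `|dot u v|.
  by apply: (He (_, _)); rewrite mem_cat orbC map_f // mem_filter v0.
move=> H; apply/eqP => /eqP; rewrite addr_eq0 => /eqP l'v; move: H.
by rewrite l'v normrN normrM (gtr0_norm e0) mulrN subrr ltxx.
Qed.

End Convexity.

(** * Vertices and edges of a polytope *)

Section Polytopes.
Context {R : realType} {d : nat}.
Implicit Types (u v x y l c : 'rV[R]_d) (A P : set 'rV[R]_d).
Implicit Types (V : {fset 'rV[R]_d}) (w : 'I_d -> 'rV[int]_d).

Lemma sub_conv_hull A x : A x -> conv_hull A x.
Proof.
move=> Ax; exists 1%N, (fun=> x), (fun=> 1).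
by split=> //; rewrite big_ord1 ?scale1r.
Qed.

Lemma conv_hull_step A x a t : conv_hull A x -> A a -> 0 <= t <= 1 ->
  conv_hull A ((1 - t) *: x + t *: a).
Proof.
move=> [n [p [b [Ap b0 b1 ->]]]] Aa /andP[t0 t1].
exists n.+1, (fun i => oapp p a (unlift ord0 i)).
exists (fun i => oapp (fun k => (1 - t) * b k) t (unlift ord0 i)); split.
- by move=> i; case: unliftP => [k|] _ /=.
- by move=> i; case: unliftP => //= k _; rewrite mulr_ge0 // subr_ge0.
- rewrite big_ord_recl unlift_none /=.
  by under eq_bigr do rewrite liftK /=; rewrite -mulr_sumr b1 mulr1 addrC subrK.
rewrite big_ord_recl unlift_none /= addrC scaler_sumr; congr (_ + _).
by apply: eq_bigr => k _; rewrite liftK /= scalerA.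
Qed.

Lemma conv_hull_cone A v x : conv_hull A x ->
  cone [set p - v | p in A] (x - v).
Proof.
move=> [n [p [b [Ap b0 b1 ->]]]].
have -> : \sum_i b i *: p i - v = \sum_i b i *: (p i - v).
  by under [RHS]eq_bigr do rewrite scalerBr; rewrite sumrB -scaler_suml b1 scale1r.
by apply: cone_sum => i; apply: cone_scale => //; apply: cone_mem; exists (p i).
Qed.

Lemma cone_conv_hull A v y : cone [set p - v | p in A] y ->
  y = 0 \/ exists t x, [/\ 0 < t, conv_hull A x & y = t *: (x - v)].
Proof.
elim=> [|{}y _ t _ IH [a Aa <-] t0]; first by left.
have [->|t_neq0] := eqVneq t 0; first by rewrite scale0r addr0.
have {t_neq0} t_gt0 : 0 < t by rewrite lt_neqAle eq_sym t_neq0.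
right; case: IH => [->|[s [x [s0 Ax ->]]]].
  by exists t, a; rewrite add0r; split=> //; apply: sub_conv_hull.
have st : 0 < s + t by rewrite addr_gt0.
exists (s + t), ((1 - t / (s + t)) *: x + (t / (s + t)) *: a); split=> //.
  apply: conv_hull_step => //; apply/andP; split; first by rewrite divr_ge0 // ltW.
  by rewrite ler_pdivrMr // mul1r lerDr ltW.
have -> : 1 - t / (s + t) = s / (s + t) by field; rewrite gt_eqF.
rewrite [RHS]scalerBr [(s + t) *: (_ + _)]scalerDr !scalerA.
rewrite ![(s + t) * _]mulrC !divfK ?gt_eqF //.
by rewrite !scalerBr scalerDl opprD addrACA.
Qed.

(** Apply [gordan] to the vectors [p - x]. In its second case either [x] equals some [p], or
    [x - p = t *: (y - x)] with [t > 0] and [y] in the hull, which places [x] on the segment from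
    [p] to [y]. *)
Lemma conv_hull_separation V x : ~ conv_hull [set` V] x ->
  exists l, forall p, p \in V -> 0 < dot l (p - x).
Proof.
move=> Vx; have [[l lV]|[_ /mapP[p pV ->]]] := gordan [seq p - x | p <- V].
  by exists l => p pV; apply: lV; apply: map_f.
move=> pc; have : cone [set q - x | q in [set` V]] (- (p - x)).
  by apply: cone_sub pc => _ /mapP[q qV ->]; exists q.
case/cone_conv_hull => [|[t [y [t0 Vy E]]]].
  move/eqP; rewrite oppr_eq0 subr_eq0 => /eqP px.
  by case: Vx; rewrite -px; apply: sub_conv_hull.
case: Vx.
have t1 : 0 < 1 + t by rewrite addr_gt0.
have -> : x = (1 - (1 + t)^-1) *: y + (1 + t)^-1 *: p.
  have -> : 1 - (1 + t)^-1 = (1 + t)^-1 * t by field; rewrite gt_eqF.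
  rewrite -scalerA -scalerDr; apply: (scalerI (lt0r_neq0 t1)).
  rewrite scalerA divff ?gt_eqF // scale1r scalerDl scale1r.
  move: E; rewrite opprB scalerBr => /eqP.
  by rewrite subr_eq addrAC eq_sym subr_eq => /eqP <-.
apply: conv_hull_step => //; rewrite invr_ge0 ltW //=.
by rewrite invf_le1 // lerDl ltW.
Qed.

(** A point of the face [dot c x = b] puts no weight off that face: the slacks [b - dot c p] are
    nonnegative and their weighted sum is 0. *)
Lemma conv_hull_dot_le A c b l m x : (forall p, A p -> dot c p <= b) ->
    (forall p, A p -> dot c p = b -> dot l p <= m) ->
  conv_hull A x -> dot c x = b -> dot l x <= m.
Proof.
move=> cA lA [n [p [a [Ap a0 a1 ->]]]] cx.
have sum0 : \sum_i a i * (b - dot c (p i)) = 0.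
  under eq_bigr do rewrite mulrBr; rewrite sumrB -mulr_suml a1 mul1r -cx.
  by apply/eqP; rewrite subr_eq0 dot_sumr; apply/eqP/eq_bigr => i _; rewrite dotZr.
have term0 i : a i * (b - dot c (p i)) = 0.
  apply: (psumr_eq0P _ sum0) => // k _; rewrite mulr_ge0 // subr_ge0; exact: cA.
rewrite -[m]mul1r -a1 mulr_suml dot_sumr; apply: ler_sum => i _; rewrite dotZr.
have /eqP := term0 i; rewrite mulf_eq0 => /orP[/eqP ->|]; first by rewrite !mul0r.
by rewrite subr_eq0 => /eqP bc; rewrite ler_wpM2l // lA.
Qed.

Lemma conv_hull_dot_ub A c b x : (forall p, A p -> dot c p <= b) ->
  conv_hull A x -> dot c x <= b.
Proof.
move=> cA Ax; apply: (@conv_hull_dot_le A 0 0 c b x) => //.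
- by move=> p _; rewrite dotC dot0r.
- by move=> p /cA.
- by rewrite dotC dot0r.
Qed.

Lemma vertex_in P v : is_vertex P v -> P v.
Proof. by move=> [c [b [_ E]]]; have : [set v] v by []; rewrite E => -[]. Qed.

Lemma vertex_exposed P v : is_vertex P v ->
  exists c, forall p, P p -> p != v -> 0 < dot c (p - v).
Proof.
move=> [c [b [cP E]]]; exists (- c) => p Pp pv.
have [_ cv] : (P `&` [set x | dot c x = b]) v by rewrite -E.
rewrite dotNl oppr_gt0 dotBr subr_lt0 cv lt_neqAle cP // andbT.
apply: contra pv => /eqP cp; apply/eqP.
have : (P `&` [set x | dot c x = b]) p by [].
by rewrite -E.
Qed.

(** Testing the generators suffices, because [x - v] lies in the cone of the vectors [p - v]. *)
Lemma exposed_vertex A v c : A v ->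
    (forall p, A p -> p != v -> 0 < dot c (p - v)) ->
  is_vertex (conv_hull A) v.
Proof.
move=> Av cA.
have pos x : conv_hull A x -> x = v \/ 0 < dot c (x - v).
  move=> /(conv_hull_cone v) cx; suff : x - v = 0 \/ 0 < dot c (x - v).
    by case=> [/eqP|]; [rewrite subr_eq0 => /eqP|]; [left|right].
  elim: cx => [|y _ t _ IH [p Ap <-] t0]; first by left.
  have [->|pv] := eqVneq p v; first by rewrite subrr scaler0 addr0.
  have [->|tn] := eqVneq t 0; first by rewrite scale0r addr0.
  have {}t0 : 0 < t by rewrite lt_neqAle eq_sym tn.
  right; rewrite dotDr dotZr; have pt := mulr_gt0 t0 (cA _ Ap pv).
  by case: IH => [->|y0]; [rewrite dot0r add0r|rewrite addr_gt0].
exists (- c), (dot (- c) v); split=> [x /pos[->//|]|].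
  by rewrite dotBr subr_gt0 !dotNl lerN2 => /ltW.
apply/seteqP; split=> [x ->|x [/pos[->//|]]] /=.
  by split=> //; apply: sub_conv_hull.
by rewrite dotBr subr_gt0 !dotNl => cx /oppr_inj E; rewrite E ltxx in cx.
Qed.

(** In a convex combination giving [v], a generator of nonzero weight has value 0 under the
    functional exposing [v], so it is [v]. *)
Lemma vertex_conv_hull A v : is_vertex (conv_hull A) v -> A v.
Proof.
move=> vP; have [c cP] := vertex_exposed vP.
have [n [p [a [Ap a0 a1 vE]]]] := vertex_in vP.
have [[i ai]|] := pselect (exists i, a i != 0); last first.
  move=> /forallNP an; have : \sum_i a i = 0.
    by apply: big1 => i _; apply/eqP; have /negP := an i; rewrite negbK.
  by move/eqP; rewrite a1 oner_eq0.
have c_ge0 k : 0 <= dot c (p k - v).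
  have [->|pv] := eqVneq (p k) v; first by rewrite subrr dot0r.
  by apply/ltW/cP => //; apply: sub_conv_hull.
have sum0 : \sum_k a k * dot c (p k - v) = 0.
  under eq_bigr do rewrite -dotZr; rewrite -dot_sumr.
  under eq_bigr do rewrite scalerBr; rewrite sumrB -scaler_suml a1 scale1r -vE.
  by rewrite subrr dot0r.
have : a i * dot c (p i - v) = 0.
  by apply: (psumr_eq0P _ sum0) => // k _; apply: mulr_ge0.
move/eqP; rewrite mulf_eq0 (negbTE ai) /= => cpi.
have [<-//|pv] := eqVneq (p i) v.
by have := cP _ (sub_conv_hull (Ap i)) pv; rewrite lt_neqAle eq_sym cpi.
Qed.

Lemma seq_argmax (T : eqType) (f : T -> R) (s : seq T) (z : T) : z \in s ->
  exists2 u : T, u \in s & forall p, p \in s -> f p <= f u.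
Proof.
elim: s z => // a s IHs z _; case: s IHs => [|b s] IHs.
  by exists a => [|p]; rewrite inE // => /eqP ->.
have [u us umax] := IHs b (mem_head _ _).
have [fau|fua] := leP (f a) (f u).
  exists u; first by rewrite inE us orbT.
  by move=> p; rewrite inE => /orP[/eqP ->|/umax].
exists a; first exact: mem_head.
move=> p; rewrite inE => /orP[/eqP ->//|/umax pu].
exact: le_trans pu (ltW fua).
Qed.

Lemma toR_neq0 (m : 'rV[int]_d) : m != 0 -> toR m != 0 :> 'rV[R]_d.
Proof.
apply: contra => /eqP/rowP m0; apply/eqP/rowP => i; apply/eqP.
by have /eqP := m0 i; rewrite !mxE intr_eq0.
Qed.

(* If the generators [G] of the tangent cone at [v] are irredundant, the theorem
   of the alternative yields for each of them a functional whose face is the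
   edge spanned by that generator. *)
Lemma edges_span_tangent_cone V v w x :
    let P := conv_hull [set` V] in
    is_vertex P v -> edge_directions P v w -> P x ->
  cone (range (fun i => toR (w i) : 'rV[R]_d)) (x - v).
Proof.
move=> P vP [F F_bij F_dir] Px.
have vV : v \in V := vertex_conv_hull vP.
have [c cP] := vertex_exposed vP.
(* Induction on the number of generators: a redundant one is dropped, and otherwise each [g] is
   shown to lie along an edge. *)
suff main (n : nat) (G : seq 'rV[R]_d) : (size G < n)%N ->
    (forall g, g \in G -> 0 < dot c g /\ (v + g \in V)) ->
    (forall p, p \in V -> cone [set` G] (p - v)) ->
    forall p, p \in V -> cone (range (fun i => toR (w i) : 'rV[R]_d)) (p - v).
  pose G := [seq p - v | p <- V & p != v].
  apply: cone_trans (conv_hull_cone v Px) => _ [p pV <-]; move: p pV.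
  apply: (main (size G).+1 G) => // [g /mapP[p]|p pV].
    rewrite mem_filter => /andP[pv pV] ->; split; last by rewrite addrC subrK.
    by apply: cP => //; apply: sub_conv_hull.
  have [->|pv] := eqVneq p v; first by rewrite subrr; apply: cone0.
  by apply: cone_mem; apply: map_f; rewrite mem_filter pv.
elim: n G => // n IHn G; rewrite ltnS => Gn GV VG.
have [[g gG gc]|irred] := pselect (exists2 g, g \in G & cone [set` rem g G] g).
  apply: (IHn (rem g G)).
  - by rewrite size_rem // (leq_trans _ Gn) // prednK //; case: (G) gG.
  - by move=> h /mem_rem/GV.
  move=> p /VG; apply: cone_trans => h /=.
  by rewrite (perm_mem (perm_to_rem gG)) inE => /orP[/eqP ->//|]; apply: cone_mem.
suff gW g : g \in G -> cone (range (fun i => toR (w i) : 'rV[R]_d)) g.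
  by move=> p /VG; apply: cone_trans.
move=> gG; have [cg vgV] := GV _ gG.
have g0 : g != 0 by apply: contraTneq cg => ->; rewrite dot0r ltxx.
have gg := dot_gt0 g0.
pose proj h := h - (dot g h / dot g g) *: g.
(* The second case would put some [t *: g] in the cone of the other generators. Here [t > 0] because
   [c] is positive on all of them, so [g] would be redundant. *)
have [[l ls]|[_ /mapP[h hG ->]]] := gordan [seq proj h | h <- rem g G]; last first.
  have lift y : cone [set` [seq proj h | h <- rem g G]] y ->
      exists t, cone [set` rem g G] (y + t *: g).
    elim=> [|{}y _ s _ [t IH] /mapP[k kG ->] s0].
      by exists 0; rewrite scale0r addr0; apply: cone0.
    exists (t + s * (dot g k / dot g g)).
    have -> : y + s *: proj k + (t + s * (dot g k / dot g g)) *: g =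
        y + t *: g + s *: k.
      by rewrite /proj scalerBr scalerDl scalerA addrACA addrNK addrAC.
    exact: coneD.
  move=> /lift[t]; rewrite /proj opprB addrAC -scalerDl.
  move: (_ + t) => {}t tc; case: irred; exists g => //.
  have tg : cone [set` rem g G] (t *: g).
    by rewrite -[t *: g](subrK h); apply: cone_add => //; apply: cone_mem.
  have ch : 0 < dot c h by have [] := GV _ (mem_rem hG).
  have : 0 <= dot c (t *: g - h).
    by apply: cone_dot_ge0 tc => k /mem_rem/GV[/ltW].
  rewrite dotBr dotZr subr_ge0 => /(lt_le_trans ch) tcg.
  have t0 : 0 < t by rewrite -(pmulr_lgt0 _ cg).
  rewrite -[X in cone _ X](scalerK (lt0r_neq0 t0)); apply: cone_scale => //.
  by rewrite invr_ge0 ltW.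
(* Made orthogonal to [g], the functional kills [g] and stays positive on the other generators, so
   it attains its minimum on the polytope along the ray of [g] only. *)
pose l' := l - (dot g l / dot g g) *: g.
have l'g : dot l' g = 0.
  by rewrite /l' dotBl dotZl divfK ?gt_eqF // dotC subrr.
have l'h h : h \in rem g G -> 0 < dot l' h.
  move=> hG; have := ls _ (map_f _ hG); rewrite /l' /proj !dotE.
  by rewrite [dot l g]dotC [_ / _ * dot g l]mulrAC [dot g h * _]mulrC [_ / _ * dot g h]mulrAC.
have l'G h : h \in G -> 0 <= dot l' h.
  by rewrite (perm_mem (perm_to_rem gG)) inE => /orP[/eqP ->|/l'h/ltW//]; rewrite l'g.
have tight y : cone [set` G] y -> dot l' y = 0 -> exists2 t, 0 <= t & y = t *: g.
  elim=> [_|{}y h s yG IH hG s0]; first by exists 0; rewrite ?scale0r.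
  have y0 : 0 <= dot l' y := cone_dot_ge0 l'G yG.
  have h0 := l'G _ hG; rewrite dotDr dotZr => E.
  have [t t0 ->] : exists2 t, 0 <= t & y = t *: g.
    by apply: IH; have := mulr_ge0 s0 h0; lra.
  have /eqP : s * dot l' h = 0 by have := mulr_ge0 s0 h0; lra.
  rewrite mulf_eq0 => /orP[/eqP ->|/eqP h00].
    by exists t; rewrite // scale0r addr0.
  move: hG; rewrite /= (perm_mem (perm_to_rem gG)) inE => /orP[/eqP ->|/l'h].
    by exists (t + s); rewrite ?addr_ge0 // scalerDl.
  by rewrite h00 ltxx.
have PG y : P y -> cone [set` G] (y - v).
  by move=> /(conv_hull_cone v); apply: cone_trans => _ [p pV <-]; apply: VG.
pose E := P `&` [set y | dot (- l') y = dot (- l') v].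
have Ev : E v by split => //; apply: vertex_in.
have Eg : E (v + g).
  by split; [apply: sub_conv_hull|rewrite /= dotDr !dotNl l'g oppr0 addr0].
have Eray y : E y -> exists2 t, 0 <= t & y = v + t *: g.
  move=> [Py /eqP]; rewrite !dotNl eqr_opp -subr_eq0 -dotBr => /eqP ly.
  have [t t0 yE] := tight _ (PG _ Py) ly; exists t => //.
  by rewrite -yE addrC subrK.
have E_edge : edges_at P v E.
  split=> //; split.
    exists (- l'), (dot (- l') v); split=> // y Py.
    by rewrite !dotNl lerN2 -subr_ge0 -dotBr; apply: cone_dot_ge0 l'G (PG _ Py).
  exists v, <[g]>%VS; split; first by rewrite dim_vline g0.
  apply/seteqP; split=> [y [n' [p [a [Ep a1 ->]]]]|y /vlineP[t yE]] /=.
    have -> : \sum_i a i *: p i - v = \sum_i a i *: (p i - v).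
      by under [RHS]eq_bigr do rewrite scalerBr; rewrite sumrB -scaler_suml a1 scale1r.
    apply: rpred_sum => i _; rewrite rpredZ //; have [t _ ->] := Eray _ (Ep i).
    by rewrite addrAC subrr add0r rpredZ // memv_line.
  exists 2%N, (fun i => if i == ord0 then v else v + g).
  exists (fun i => if i == ord0 then 1 - t else t); split.
  - by move=> i; case: ifP.
  - by rewrite big_ord_recl big_ord1 /= subrK.
  rewrite big_ord_recl big_ord1 /= scalerDr addrA -scalerDl subrK scale1r -yE.
  by rewrite addrC subrK.
have [i FiE] : exists i, F i = E.
  by have [_ _ /(_ _ E_edge)[i _ FE]] := F_bij; exists i.
have [/toR_neq0 wi0 [t t0]] := F_dir i; rewrite FiE => /Eray[s s0 /addrI tw].
have s_neq0 : s != 0.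
  apply: contraNneq wi0 => s00; move/eqP: tw.
  by rewrite s00 scale0r scaler_eq0 gt_eqF.
rewrite -[g](scalerK s_neq0) -tw scalerA; apply: cone_scale.
  by rewrite mulr_ge0 ?invr_ge0 // ltW.
by apply: cone_mem; exists i.
Qed.

End Polytopes.

(** * Coordinates in a basis of edge vectors *)

Section Coordinates.
Context {R : realType} {d : nat}.
Implicit Types (x y l : 'rV[R]_d) (W : 'I_d -> 'rV[R]_d).

Definition frame W : 'M[R]_d := \matrix_(i < d) W i.

Definition coord W (i : 'I_d) x : R := (x *m invmx (frame W)) 0 i.

Lemma coord_decomp W x : frame W \in unitmx -> x = \sum_i coord W i x *: W i.
Proof.
move=> Wu; rewrite -{1}[x](mulmxKV Wu) mulmx_sum_row.
by apply: eq_bigr => i _; rewrite rowK.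
Qed.

Lemma coord_sum W (a : 'I_d -> R) i : frame W \in unitmx ->
  coord W i (\sum_k a k *: W k) = a i.
Proof.
move=> Wu; have -> : \sum_k a k *: W k = (\row_k a k) *m frame W.
  by rewrite mulmx_sum_row; apply: eq_bigr => k _; rewrite mxE rowK.
by rewrite /coord mulmxK // mxE.
Qed.

Lemma coordD W i x y : coord W i (x + y) = coord W i x + coord W i y.
Proof. by rewrite /coord mulmxDl mxE. Qed.

Lemma coordZ W i a x : coord W i (a *: x) = a * coord W i x.
Proof. by rewrite /coord -scalemxAl mxE. Qed.

Lemma coord0 W i : coord W i 0 = 0.
Proof. by rewrite /coord mul0mx mxE. Qed.

Lemma coordN W i x : coord W i (- x) = - coord W i x.
Proof. by rewrite /coord mulNmx mxE. Qed.

Lemma coordB W i x y : coord W i (x - y) = coord W i x - coord W i y.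
Proof. by rewrite coordD coordN. Qed.

Lemma coord_base W i k : frame W \in unitmx -> coord W i (W k) = (i == k)%:R.
Proof.
move=> Wu; have -> : W k = \sum_j (j == k)%:R *: W j.
  rewrite (bigD1 k) //= eqxx scale1r big1 ?addr0 // => j /negbTE ->.
  by rewrite scale0r.
by rewrite coord_sum.
Qed.

Lemma frame_neq0 W k : frame W \in unitmx -> W k != 0.
Proof.
move=> Wu; apply/eqP => Wk; have := coord_base k k Wu.
by rewrite Wk coord0 eqxx => /esym/eqP; rewrite oner_eq0.
Qed.

Lemma cone_coord_ge0 W i x : frame W \in unitmx -> cone (range W) x ->
  0 <= coord W i x.
Proof.
move=> Wu; elim=> [|{}x _ t _ IH [k _ <-] t0]; first by rewrite coord0.
by rewrite coordD coordZ coord_base // addr_ge0 ?mulr_ge0.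
Qed.

Lemma frame_unitmx W : (forall l, (forall i, dot l (W i) = 0) -> l = 0) ->
  frame W \in unitmx.
Proof.
move=> Winj; rewrite -unitmx_tr -row_free_unit -kermx_eq0.
apply/rowV0P => l /sub_kermxP lW; apply: Winj => i.
have /rowP/(_ i) := lW; rewrite !mxE => E; rewrite -[RHS]E.
by apply: eq_bigr => k _; rewrite !mxE.
Qed.

(* Modulo the common direction [W i] (a negative multiple of [W' j]), the two
   frames expand each other with nonnegative coefficients. Two mutually inverse
   nonnegative matrices are monomial. *)
Lemma frames_of_adjacent_cones W W' i j :
    frame W \in unitmx -> frame W' \in unitmx ->
    (exists2 c, 0 < c & W' j = - c *: W i) ->
    (forall m k, m != j -> k != i -> 0 <= coord W k (W' m)) ->
    (forall m k, m != j -> k != i -> 0 <= coord W' m (W k)) ->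
  exists f : 'I_d -> 'I_d, [/\ injective f, f j = i &
    forall m, m != j -> exists b c, 0 < b /\ W (f m) = b *: W' m + c *: W i].
Proof.
move=> Wu W'u [c c0 W'j] A0 B0.
have Wi : W i = - c^-1 *: W' j.
  by rewrite W'j scalerA mulrNN mulVf ?scale1r ?gt_eqF.
have coord'i m : m != j -> coord W' m (W i) = 0.
  by move=> mj; rewrite Wi coordZ coord_base // (negbTE mj) mulr0.
pose good m k := (k != i) && (coord W k (W' m) != 0).
(* Otherwise [W' m] is a multiple of [W i], hence of [W' j], against independence. *)
have good_ex m : m != j -> exists k, good m k.
  move=> mj; apply: contrapT => /forallNP bad.
  have W'm : W' m = coord W i (W' m) *: W i.
    rewrite {1}[W' m](coord_decomp _ Wu) (bigD1 i) //= big1 ?addr0 // => k ki.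
    by have /negP := bad k; rewrite /good ki negbK => /eqP ->; rewrite scale0r.
  have := coord_base m m W'u; rewrite W'm coordZ coord'i // mulr0 eqxx.
  by move/esym/eqP; rewrite oner_eq0.
(* An off-diagonal entry of the product of the two matrices is 0 and a sum of nonnegative terms, so
   each term vanishes. *)
have good0 m k n : m != j -> good m k -> n != j -> n != m ->
    coord W' n (W k) = 0.
  move=> mj /andP[ki Ak] nj nm.
  have := coord_base n m W'u; rewrite {1}[W' m](coord_decomp _ Wu) (negbTE nm).
  rewrite (_ : coord _ _ _ = \sum_l coord W l (W' m) * coord W' n (W l)); last first.
    rewrite (big_morph (coord W' n) (coordD W' n) (coord0 W' n)).
    by apply: eq_bigr => l _; rewrite coordZ.
  rewrite (bigD1 i) //= coord'i // mulr0 add0r => sum0.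
  have /eqP : coord W k (W' m) * coord W' n (W k) = 0.
    by apply: (psumr_eq0P _ sum0) => // l li; rewrite mulr_ge0 ?A0 ?B0.
  by rewrite mulf_eq0 (negbTE Ak) => /eqP.
pose f m := if m == j then i else odflt i [pick k | good m k].
have f_good m : m != j -> good m (f m).
  move=> mj; rewrite /f (negbTE mj); case: pickP => //= none.
  by have [k] := good_ex m mj; rewrite none.
have fE m : m != j ->
    W (f m) = coord W' m (W (f m)) *: W' m + (coord W' j (W (f m)) * - c) *: W i.
  move=> mj; rewrite -scalerA -W'j {1}[W (f m)](coord_decomp _ W'u).
  rewrite (bigD1 m) //= (bigD1 j) //= 1?eq_sym // big1 ?addr0 // => n /andP[nm nj].
  by rewrite (good0 m) ?scale0r // f_good.
have f_pos m : m != j -> 0 < coord W' m (W (f m)).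
  move=> mj; have /andP[fi _] := f_good m mj.
  rewrite lt_neqAle B0 // andbT; apply/eqP => b0.
  have := coord_base (f m) (f m) Wu; rewrite fE // -b0 scale0r add0r coordZ.
  by rewrite coord_base // (negbTE fi) mulr0 eqxx => /esym/eqP; rewrite oner_eq0.
exists f; split; last first.
- move=> m mj; exists (coord W' m (W (f m))), (coord W' j (W (f m)) * - c).
  by rewrite f_pos -?fE.
- by rewrite /f eqxx.
move=> m n; have [->|mj] := eqVneq m j; have [->|nj] := eqVneq n j => //.
- by case/andP: (f_good n nj) => + _; rewrite {2}/f eqxx => /eqP + /esym.
- by case/andP: (f_good m mj) => + _; rewrite {3}/f eqxx => /eqP.
move=> fmn; apply/eqP; apply: contraT => nm.
have := f_pos m mj; rewrite fmn (good0 n) ?ltxx ?f_good //.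
Qed.

End Coordinates.

(** * Endpoints of edges and independence of edge directions *)

Section SimplePolytopes.
Context {R : realType} {d : nat}.
Implicit Types (u v x y l c : 'rV[R]_d) (A P : set 'rV[R]_d).
Implicit Types (V : {fset 'rV[R]_d}) (w : 'I_d -> 'rV[int]_d).

Definition edge_vectors w (i : 'I_d) : 'rV[R]_d := toR (w i).

(** The other end [u] maximizes [toR (w i)] among the generators on the edge. The edge is also one
    of the edges at [u], where its direction must point back towards [v]. *)
Lemma edge_endpoint V v w i :
    let P := conv_hull [set` V] in
    is_vertex P v -> edge_directions P v w ->
    (forall F, is_edge P F -> rational_direction F) ->
  exists u t, [/\ is_vertex P u, 0 < t, u = v + t *: edge_vectors w i &
    forall w', edge_directions P u w' ->
      exists j, exists2 c, 0 < c & edge_vectors w' j = - c *: edge_vectors w i].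
Proof.
move=> P vP [F [F_at F_inj F_surj] F_dir] P_rat.
have [wi0 [t0 t0_gt0 Ft0]] := F_dir i; set E := F i in Ft0.
have [E_edge Ev] : edges_at P v E by apply: F_at.
have {wi0} wi0 := toR_neq0 (R := R) wi0.
rewrite /edge_vectors; set wi : 'rV[R]_d := toR (w i) in Ft0 wi0 *.
have ww := dot_gt0 wi0.
have [w0 _ Eline] := P_rat E E_edge.
(* The rational direction [w0] of the edge and the chosen [w i] are proportional, as [v] and
   [v + t0 *: wi] both lie on the edge. *)
have {Eline} line x : E x -> exists s, x = v + s *: wi.
  move=> Ex; have [s xE] := Eline _ _ Ev Ex; have [r] := Eline _ _ Ev Ft0.
  rewrite addrAC subrr add0r => rE.
  have wi_r : wi = (t0^-1 * r) *: toR w0 by rewrite -scalerA -rE scalerK ?gt_eqF.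
  have r0 : t0^-1 * r != 0.
    by apply: contraNneq wi0 => r0; rewrite wi_r r0 scale0r.
  exists (s / (t0^-1 * r)); rewrite wi_r scalerA divfK // -xE.
  by rewrite addrC subrK.
have [[c [b [cP EE]]] _] := E_edge.
have inE p : P p -> dot c p = b -> E p by move=> Pp cp; rewrite EE.
have Ec p : E p -> P p /\ dot c p = b by rewrite EE.
have vV : v \in V := vertex_conv_hull vP.
have VP p : p \in V -> P p by move=> pV; apply: sub_conv_hull.
pose VE := [seq p <- V | dot c p == b].
have [|u] := @seq_argmax _ _ (dot wi) VE v.
  by rewrite mem_filter vV (Ec _ Ev).2 eqxx.
rewrite mem_filter => /andP[/eqP cu uV] umax.
have Eu : E u by apply: inE => //; apply: VP.
have u_ub x : E x -> dot wi x <= dot wi u.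
  move=> /Ec[Px cx]; apply: (conv_hull_dot_le _ _ Px cx) => p pV.
    exact/cP/VP.
  by move=> cp; apply: umax; rewrite mem_filter cp eqxx.
have [s uE] := line u Eu.
have s_gt0 : 0 < s.
  have := u_ub _ Ft0; rewrite uE !dotDr !dotZr lerD2l ler_pM2r //.
  exact: lt_le_trans.
exists u, s; split=> //.
  (* [c] exposes the edge, and a small multiple of [wi] then singles out [u] on it. *)
  have [|e e0 He] := @small_perturbation _
      [seq (b - dot c p, dot wi u - dot wi p) | p <- V & dot c p != b].
    move=> q /mapP[p]; rewrite mem_filter => /andP[cp pV] ->.
    by rewrite subr_gt0 lt_neqAle cp cP //; apply: VP.
  apply: (@exposed_vertex _ _ _ u (- (c + e *: wi))) => // p pV pu.
  have -> : dot (- (c + e *: wi)) (p - u) =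
      (b - dot c p) + e * (dot wi u - dot wi p).
    by rewrite !dotE cu; ring.
  have [cp|cp] := eqVneq (dot c p) b; last first.
    apply: (He (_, _)).
    by apply: (map_f (fun p => (_ - dot c p, _ - dot wi p))); rewrite mem_filter cp.
  rewrite cp subrr add0r mulr_gt0 // subr_gt0 lt_neqAle u_ub ?andbT; last first.
    by apply: inE => //; apply: VP.
  apply: contra pu => /eqP; have [r ->] := line p (inE _ (VP _ pV) cp).
  by rewrite uE !dotDr !dotZr => /addrI/(mulIf (lt0r_neq0 ww)) ->.
move=> w' [F' [_ _ F'_surj] F'_dir].
have [j _ FjE] := F'_surj E (conj E_edge Eu).
have [/(toR_neq0 (R := R)) wj0 [r r0]] := F'_dir j; rewrite FjE => Er.
exists j; have [q qE] := line _ Er.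
have rE : r *: toR (w' j) = (q - s) *: wi.
  by move: qE; rewrite uE -addrA => /addrI E'; rewrite scalerBl -E' addrAC subrr add0r.
have wjE : toR (w' j) = (r^-1 * (q - s)) *: wi by rewrite -scalerA -rE scalerK ?gt_eqF.
exists (- (r^-1 * (q - s))); last by rewrite opprK.
have := u_ub _ Er; rewrite qE uE !dotDr !dotZr lerD2l ler_pM2r // => qs.
rewrite oppr_gt0 pmulr_rlt0 ?invr_gt0 // subr_lt0 lt_neqAle qs andbT.
by apply: contraNneq wj0 => qs0; rewrite wjE qs0 subrr mulr0 scale0r.
Qed.

(** A functional [l] killing all edge vectors at [v] is constant on the polytope, since these
    generate the tangent cone. It is then constant on the affine hull, which is everything;
    comparing [v] with [v + l] gives [dot l l = 0]. *)
Lemma edge_frame_unitmx V v w :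
    let P := conv_hull [set` V] in
    has_dim P d -> is_vertex P v -> edge_directions P v w ->
  frame (edge_vectors w) \in unitmx.
Proof.
move=> P [x0 [U [dimU affP]]] vP wP; apply: frame_unitmx => l lw.
have Pl x : P x -> dot l (x - v) = 0.
  move=> /(edges_span_tangent_cone vP wP).
  elim=> [|y _ t _ IH [i _ <-] _]; first by rewrite dot0r.
  by rewrite dotDr IH dotZr lw mulr0 addr0.
have Ufull : U = fullv by apply/eqP; rewrite eqEdim subvf dimvf dimU /dim /= mul1n.
have : aff_hull P (v + l) by rewrite affP /= Ufull memvf.
move=> [n [p [a [Pp a1 E]]]]; apply/eqP; apply: contraT => /dot_gt0.
have -> : dot l l = dot l (\sum_i a i *: (p i - v)).
  congr dot; under eq_bigr do rewrite scalerBr.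
  by rewrite sumrB -E -scaler_suml a1 scale1r addrAC subrr add0r.
by rewrite dot_sumr big1 ?ltxx // => i _; rewrite dotZr Pl // mulr0.
Qed.

End SimplePolytopes.

(** * Half-open cones as sign patterns of coordinates *)

Section Sectors.
Context {R : realType} {d : nat}.
Implicit Types (u v x xi : 'rV[R]_d) (w : 'I_d -> 'rV[int]_d) (S : {set 'I_d}).

(** The half-open cones freed from [xi]: the sectors at [v], over all [S], partition the space. *)
Definition sector w v S : set 'rV[R]_d :=
  [set x | forall i, (i \in S) = (coord (edge_vectors w) i (x - v) < 0)].

Lemma half_open_coneE w xi v : frame (edge_vectors (R := R) w) \in unitmx ->
    (forall i, dot (edge_vectors w i) xi != 0) ->
  half_open_cone w xi v = sector w v (Eminus w xi).
Proof.
move=> wu w_gen.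
have EplusE i : (i \in Eplus w xi) = (i \notin Eminus w xi).
  rewrite !inE -/(edge_vectors w i).
  by have := w_gen i; case: ltgtP.
have sumE (a : 'I_d -> R) : \sum_(i in Eplus w xi) a i *: toR (w i) +
    \sum_(i in Eminus w xi) a i *: toR (w i) = \sum_i a i *: edge_vectors w i.
  rewrite [RHS](bigID (mem (Eminus w xi))) /= addrC; congr (_ + _).
  by apply: eq_bigl => i; rewrite EplusE.
apply/seteqP; split=> x /=.
  move=> [a [a_ge0 a_lt0 ->]] i.
  rewrite -[v + _ + _]addrA sumE addrAC subrr add0r coord_sum //.
  have [iE|iE] := boolP (i \in Eminus w xi); first by rewrite a_lt0.
  by apply/esym/le_gtF/a_ge0; rewrite EplusE.
move=> xS; exists (fun i => coord (edge_vectors w) i (x - v)); split.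
- by move=> i; rewrite EplusE xS -leNgt.
- by move=> i; rewrite xS.
by rewrite -addrA sumE -coord_decomp // addrC subrK.
Qed.

End Sectors.

(** * The Lawrence-Varchenko identity of indicator functions *)

Section LawrenceVarchenko.
Context {R : realType} {d : nat}.
Context (V : {fset 'rV[R]_d}) (w : 'rV[R]_d -> 'I_d -> 'rV[int]_d).
Let P : set 'rV[R]_d := conv_hull [set` V].
Context (P_dim : has_dim P d).
Context (P_rational : forall F : set 'rV[R]_d, is_edge P F -> rational_direction F).
Context (w_edges : forall v : 'rV[R]_d, is_vertex P v -> edge_directions P v (w v)).
Implicit Types (u v x p q xi eta : 'rV[R]_d).

Let W v : 'I_d -> 'rV[R]_d := edge_vectors (w v).

Definition vertex_fset : {fset 'rV[R]_d} := [fset v in V | `[< is_vertex P v >]]%fset.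

(** The value is 1 for an ascending edge and a nonnegative coordinate, -1 for a non-ascending edge
    and a negative coordinate, and 0 otherwise. The dependence on [xi] and that on [x] are separate
    summands. *)
Definition cone_factor x v xi (i : 'I_d) : int :=
  (0 < dot xi (W v i))%R%:R - (coord (W v) i (x - v) < 0)%R%:R.

(* For generic [xi] this is [(-1)^|E^-|] times the indicator of the half-open
   cone at [x] (see [signed_sector]); the product form isolates the single
   factor that jumps when [xi] crosses the wall of one edge. *)
Definition cone_term x v xi : int := \prod_i cone_factor x v xi i.

Definition cone_count x xi : int := \sum_(v <- vertex_fset) cone_term x v xi.

(** Imposed on all chords of [V]; edge vectors are covered because each is a positive multiple of a
    chord ([edge_vector_chord]). *)
Definition generic xi : Prop :=
  forall p q, p \in V -> q \in V -> p != q -> dot xi (p - q) != 0.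

Lemma mem_vertex_fset v : v \in vertex_fset <-> is_vertex P v.
Proof.
rewrite !inE /=; split=> [/andP[_ /asboolP]//|vP].
by apply/andP; split; [exact: vertex_conv_hull vP|apply/asboolP].
Qed.

Lemma frameW v : is_vertex P v -> frame (W v) \in unitmx.
Proof. by move=> vP; apply: edge_frame_unitmx P_dim vP (w_edges vP). Qed.

Lemma polytope_coord_ge0 v x i : is_vertex P v -> P x -> 0 <= coord (W v) i (x - v).
Proof.
move=> vP Px; apply: cone_coord_ge0; first exact: frameW.
exact: edges_span_tangent_cone vP (w_edges vP) Px.
Qed.

Lemma vertex_V v : is_vertex P v -> v \in V.
Proof. exact: vertex_conv_hull. Qed.

Lemma edge_vector_chord v i : is_vertex P v ->
  exists u t, [/\ is_vertex P u, 0 < t, u != v & W v i = t *: (u - v)].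
Proof.
move=> vP; have [u [t [uP t0 uE _]]] := edge_endpoint i vP (w_edges vP) P_rational.
have Wi0 := frame_neq0 i (frameW vP).
exists u, t^-1; split=> //; rewrite ?invr_gt0 //.
  by rewrite uE -subr_eq0 addrAC subrr add0r scaler_eq0 negb_or gt_eqF.
by rewrite uE addrAC subrr add0r scalerK ?gt_eqF.
Qed.

(** If [u'] differed from [u], the functionals exposing [v], [u] and [u'] would exclude in turn
    [r <= 0], [r >= 1] and the values strictly between. *)
Lemma three_collinear_vertices v u u' r :
  is_vertex P v -> is_vertex P u -> is_vertex P u' -> u != v -> u' != v ->
  u' - v = r *: (u - v) -> u' = u.
Proof.
move=> vP uP u'P uv u'v E; apply/eqP; apply: contraT => u'u.
have Pin := @vertex_in _ _ P.
have u'E : u' = v + r *: (u - v) by rewrite -E addrC subrK.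
have [c cv] := vertex_exposed vP; have [c1 cu] := vertex_exposed uP.
have [c2 cu'] := vertex_exposed u'P.
have := cv _ (Pin _ uP) uv; have := cv _ (Pin _ u'P) u'v.
have : 0 < dot c1 (v - u) by apply: cu; [apply: Pin|rewrite eq_sym].
have : 0 < dot c1 (u' - u) by apply: cu; [apply: Pin|].
have : 0 < dot c2 (v - u') by apply: cu'; [apply: Pin|rewrite eq_sym].
have : 0 < dot c2 (u - u') by apply: cu'; [apply: Pin|rewrite eq_sym].
rewrite u'E !dotE.
move: (dot c u) (dot c v) (dot c1 u) (dot c1 v) (dot c2 u) (dot c2 v).
move=> a b a1 b1 a2 b2 H1 H2 H3 H4 H5 H6.
have r0 : 0 < r by nra.
have r1 : r < 1 by nra.
have : (0 : R) < 0 by nra.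
by rewrite ltxx.
Qed.

(** * Crossing a single wall *)

Section WallCrossing.
Context (x xi0 xi1 xi eta : 'rV[R]_d).
Context (xi0_gen : generic xi0) (xi1_gen : generic xi1) (eta_gen : generic eta).
(* [xi] is the point where the path from [xi0] to [xi1] crosses a wall. *)
Context (xi_agree : forall p q, p \in V -> q \in V -> 0 < dot xi (p - q) ->
  0 < dot xi0 (p - q) /\ 0 < dot xi1 (p - q)).
Context (xi_wall : forall p q p' q', p \in V -> q \in V -> p' \in V -> q' \in V ->
  dot xi (p - q) = 0 -> dot xi (p' - q') = 0 ->
  dot eta (p - q) *: (p' - q') = dot eta (p' - q') *: (p - q)).

Lemma generic_edge z v i : generic z -> is_vertex P v -> dot z (W v i) != 0.
Proof.
move=> z_gen vP; have [u [t [uP t0 uv ->]]] := edge_vector_chord i vP.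
rewrite dotZr mulf_neq0 //; first by rewrite gt_eqF.
by apply: z_gen => //; apply: vertex_V.
Qed.

Lemma edge_sign v i : is_vertex P v -> dot xi (W v i) != 0 ->
  (0 < dot xi0 (W v i)) = (0 < dot xi (W v i)) /\
  (0 < dot xi1 (W v i)) = (0 < dot xi (W v i)).
Proof.
move=> vP; have [u [t [uP t0 uv ->]]] := edge_vector_chord i vP.
have uV := vertex_V uP; have vV := vertex_V vP.
rewrite !dotZr !pmulr_rgt0 // mulf_eq0 gt_eqF //= => xi_neq0.
have [xi_lt0|xi_gt0|] := ltgtP 0 (dot xi (u - v)).
- by have [-> ->] := xi_agree uV vV xi_lt0.
- have [] := @xi_agree v u vV uV; first by rewrite -opprB dotNr oppr_gt0.
  by rewrite -opprB !dotNr !oppr_gt0 => /ltW/le_gtF -> /ltW/le_gtF ->.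
by move/esym/eqP; rewrite (negbTE xi_neq0).
Qed.

(** [eta] serves to measure chords: it vanishes on none, so [xi_wall] makes two chords killed by
    [xi] proportional, in the ratio of their [eta] values. *)
Lemma wall_parallel v i v' i' : is_vertex P v -> is_vertex P v' ->
  dot xi (W v i) = 0 -> dot xi (W v' i') = 0 -> exists r, W v' i' = r *: W v i.
Proof.
move=> vP v'P; have [u [t [uP t0 uv ->]]] := edge_vector_chord i vP.
have [u' [t' [u'P t'0 u'v' ->]]] := edge_vector_chord i' v'P.
rewrite !dotZr => /eqP; rewrite mulf_eq0 gt_eqF //= => /eqP xiu.
move=> /eqP; rewrite mulf_eq0 gt_eqF //= => /eqP xiu'.
have V' := vertex_V; have E := xi_wall (V' _ uP) (V' _ vP) (V' _ u'P) (V' _ v'P) xiu xiu'.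
have eta0 := eta_gen (V' _ uP) (V' _ vP) uv.
exists (t' * ((dot eta (u - v))^-1 * dot eta (u' - v')) / t).
by rewrite scalerA divfK ?gt_eqF // -!scalerA -E scalerK.
Qed.

Lemma wall_edge_unique v i k : is_vertex P v ->
  dot xi (W v i) = 0 -> dot xi (W v k) = 0 -> k = i.
Proof.
move=> vP xi_i xi_k; have [r E] := wall_parallel vP vP xi_i xi_k.
have := coord_base k k (frameW vP); rewrite E coordZ coord_base ?frameW //.
by rewrite eqxx; case: eqP => // _ /eqP; rewrite mulr0 eq_sym oner_eq0.
Qed.

Let jump v := cone_term x v xi1 - cone_term x v xi0.

Lemma jump_off_wall v : is_vertex P v -> (forall i, dot xi (W v i) != 0) -> jump v = 0.
Proof.
move=> vP off; apply/eqP; rewrite subr_eq0; apply/eqP/eq_bigr => i _.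
by have [s0 s1] := edge_sign vP (off i); rewrite /cone_factor s0 s1.
Qed.

(** The edge in the wall joins [v] to [u]. All other factors match under the bijection [f] of edges
    and do not jump, while the factor of this edge sees it reversed. *)
Lemma jump_across_edge v i : is_vertex P v -> dot xi (W v i) = 0 ->
  exists u, [/\ is_vertex P u, u != v, dot xi u = dot xi v & jump u = - jump v].
Proof.
move=> vP xi_i; have vu := frameW vP.
have [u [t [uP t0 uE /(_ _ (w_edges uP))[j [c c0 Wj]]]]] :=
  edge_endpoint i vP (w_edges vP) P_rational.
rewrite -/(W v) in uE Wj; rewrite -/(W u) in Wj.
have uu := frameW uP.
have Wi : W v i = - c^-1 *: W u j by rewrite Wj scalerA mulrNN mulVf ?scale1r ?gt_eqF.
have coord_v k : k != i -> coord (W v) k (W v i) = 0.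
  by move=> /negbTE ki; rewrite coord_base // ki.
have coord_u m : m != j -> coord (W u) m (W v i) = 0.
  by move=> /negbTE mj; rewrite Wi coordZ coord_base // mj mulr0.
(* For nonnegativity, an edge vector at one endpoint is a positive multiple of [p] minus that
   endpoint, for a vertex [p]. Passing to the other endpoint only adds a multiple of [W v i],
   invisible to the coordinates in question. *)
have [|||f [f_inj fj f_rel]] := @frames_of_adjacent_cones _ _ (W v) (W u) i j vu uu.
- by exists c.
- move=> m k mj ki; have [p [s [pP s0 _ ->]]] := edge_vector_chord m uP.
  rewrite coordZ mulr_ge0 //; first exact: ltW.
  rewrite uE opprD addrA coordB coordZ coord_v //.
  rewrite mulr0 subr0.
  exact: polytope_coord_ge0 vP (vertex_in pP).
- move=> m k mj ki; have [p [s [pP s0 _ ->]]] := edge_vector_chord k vP.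
  rewrite coordZ mulr_ge0 //; first exact: ltW.
  have -> : p - v = p - u + t *: W v i by rewrite uE opprD addrA subrK.
  rewrite coordD coordZ coord_u // mulr0 addr0.
  exact: polytope_coord_ge0 uP (vertex_in pP).
exists u; split=> //.
- by rewrite uE -subr_eq0 addrAC subrr add0r scaler_eq0 gt_eqF //= frame_neq0.
- by rewrite uE dotDr dotZr xi_i mulr0 addr0.
(* Off the common edge, [x] has the same coordinate signs at [u] and at [v]. *)
have coord_x m : m != j -> exists2 b, 0 < b &
    coord (W u) m (x - u) = b * coord (W v) (f m) (x - v).
  move=> mj; have [b [b' [b0 fm]]] := f_rel m mj; exists b => //.
  have -> : x - u = x - v - t *: W v i by rewrite uE opprD addrA.
  rewrite [LHS]coordB.
  rewrite coordZ coord_u // mulr0 subr0.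
  rewrite {1}(coord_decomp (x - v) vu) (big_morph _ (coordD _ m) (coord0 _ m)).
  rewrite (reindex_inj f_inj) (bigD1 m) //= big1 ?addr0.
    rewrite coordZ mulrC; congr (_ * _).
    by rewrite fm coordD !coordZ coord_u // coord_base // eqxx mulr0 addr0 mulr1.
  move=> n nm; rewrite coordZ (_ : coord (W u) m (W v (f n)) = 0) ?mulr0 //.
  have [->|nj] := eqVneq n j; first by rewrite fj coord_u.
  have [b1 [b1' [_ ->]]] := f_rel n nj.
  by rewrite coordD !coordZ coord_u // coord_base // eq_sym (negbTE nm) !mulr0 addr0.
have factor m : m != j ->
    [/\ cone_factor x u xi0 m = cone_factor x v xi0 (f m),
        cone_factor x u xi1 m = cone_factor x v xi1 (f m) &
        cone_factor x v xi1 (f m) = cone_factor x v xi0 (f m)].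
  move=> mj; have [b b0 xE] := coord_x m mj; have [b1 [b1' [b10 fm]]] := f_rel m mj.
  have xi_m : dot xi (W u m) != 0.
    apply: contra mj => /eqP xi_m; apply/eqP; apply: (wall_edge_unique uP _ xi_m).
    by rewrite Wj dotZr xi_i mulr0.
  have xi_fm : dot xi (W v (f m)) = b1 * dot xi (W u m).
    by rewrite fm dotDr !dotZr xi_i mulr0 addr0.
  have xi_fm0 : dot xi (W v (f m)) != 0 by rewrite xi_fm mulf_neq0 // gt_eqF.
  have [su0 su1] := edge_sign uP xi_m; have [sv0 sv1] := edge_sign vP xi_fm0.
  by rewrite /cone_factor su0 su1 sv0 sv1 xi_fm pmulr_rgt0 // xE pmulr_rlt0.
rewrite /jump /cone_term [in RHS](reindex_inj f_inj) [in X in - (_ - X)](reindex_inj f_inj) /=.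
rewrite !(bigD1 (P := xpredT) j) //= fj.
have -> : \prod_(m | m != j) cone_factor x u xi1 m =
    \prod_(m | m != j) cone_factor x v xi0 (f m).
  by apply: eq_bigr => m /factor[_ -> ->].
have -> : \prod_(m | m != j) cone_factor x u xi0 m =
    \prod_(m | m != j) cone_factor x v xi0 (f m).
  by apply: eq_bigr => m /factor[-> _ _].
have -> : \prod_(m | m != j) cone_factor x v xi1 (f m) =
    \prod_(m | m != j) cone_factor x v xi0 (f m).
  by apply: eq_bigr => m /factor[_ _ ->].
(* In the one factor left, the coordinate part cancels between [xi1] and [xi0]; reversing the edge
   negates the rest. *)
rewrite -!mulrBl -mulNr; congr (_ * _); rewrite /cone_factor Wj !dotZr !mulNr !oppr_gt0.
rewrite !pmulr_rlt0 //.
have flip (y : R) : y != 0 -> (y < 0)%R%:R = 1 - (0 < y)%R%:R :> int.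
  by case: ltgtP.
rewrite (flip _ (generic_edge i xi0_gen vP)) (flip _ (generic_edge i xi1_gen vP)).
by ring.
Qed.

(** Vertices are paired by equal value of [xi]. A mate is unique, since two mates of [v] would be
    collinear with it. *)
Lemma wall_crossing : cone_count x xi0 = cone_count x xi1.
Proof.
pose mate v u := [/\ is_vertex P u, u != v & dot xi u = dot xi v].
have mate_unique v u u' : is_vertex P v -> mate v u -> mate v u' -> u' = u.
  move=> vP [uP uv xiu] [u'P u'v xiu'].
  have V' := vertex_V; have E : dot eta (u - v) *: (u' - v) = dot eta (u' - v) *: (u - v).
    by apply: xi_wall; rewrite ?V' // dotBr ?xiu ?xiu' subrr.
  apply: (@three_collinear_vertices v u u' ((dot eta (u - v))^-1 * dot eta (u' - v))) => //.
  by rewrite -scalerA -E scalerK // eta_gen ?V'.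
(* The default [v] fixes a vertex without a mate. It has no edge in the wall, hence no jump. *)
pose sigma v := xget v [set u | mate v u].
have sigma_mate v u : is_vertex P v -> mate v u -> sigma v = u.
  move=> vP vu; rewrite /sigma; case: xgetP => [u' _ vu'|/(_ u)//].
  exact: mate_unique vP vu vu'.
have mate_sym v u : is_vertex P v -> mate v u -> mate u v.
  by move=> vP [uP uv E]; split=> //; rewrite eq_sym.
have sigmaP v : is_vertex P v -> sigma v = v \/ mate v (sigma v).
  by rewrite /sigma; case: xgetP => [u _ vu|]; [right|left].
have sigma_vertex v : is_vertex P v -> is_vertex P (sigma v).
  by move=> vP; case: (sigmaP v vP) => [->//|[]].
have sigmaK v : is_vertex P v -> sigma (sigma v) = v.
  move=> vP; case: (sigmaP v vP) => [E|vu]; first by rewrite !E.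
  by apply: sigma_mate; [apply: sigma_vertex|apply: mate_sym].
(* Mates need not be adjacent. A nonzero jump, however, forces an edge in the wall, whose other end
   is then the unique mate. *)
have jump_wall v u : is_vertex P v -> mate v u -> jump u != 0 \/ jump v != 0 ->
    jump u = - jump v.
  have main a b : is_vertex P a -> mate a b -> jump a != 0 -> jump b = - jump a.
    move=> aP ab ja; have [/existsP[i /eqP xi_i]|/existsPn off] :=
      boolP [exists i, dot xi (W a i) == 0]; last first.
      by rewrite jump_off_wall ?eqxx in ja.
    have [b' [b'P b'a xib' <-]] := jump_across_edge aP xi_i.
    by congr jump; apply: (mate_unique a).
  move=> vP vu [ju|jv]; last exact: main.
  by rewrite (main u v) ?opprK //; [case: vu|apply: mate_sym].
have jump_sigma v : is_vertex P v -> jump (sigma v) = - jump v.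
  move=> vP; case: (sigmaP v vP) => [E|vu].
    rewrite E; have [/existsP[i /eqP xi_i]|/existsPn off] :=
      boolP [exists i, dot xi (W v i) == 0]; last by rewrite jump_off_wall ?oppr0.
    have [u [uP uv xiu _]] := jump_across_edge vP xi_i.
    have := sigma_mate v u vP (And3 uP uv xiu); rewrite E => vu.
    by rewrite vu eqxx in uv.
  have [j0|j0] := eqVneq (jump (sigma v)) 0; have [j1|j1] := eqVneq (jump v) 0.
  - by rewrite j0 j1 oppr0.
  - by apply: jump_wall => //; right.
  - by apply: jump_wall => //; left.
  - by apply: jump_wall => //; left.
have perm_sigma : perm_eq [seq sigma v | v <- vertex_fset] vertex_fset.
  have sV v : v \in vertex_fset -> sigma v \in vertex_fset.
    by move=> /mem_vertex_fset/sigma_vertex ?; apply/mem_vertex_fset.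
  apply: uniq_perm => //.
    rewrite map_inj_in_uniq ?fset_uniq // => a b /mem_vertex_fset aP /mem_vertex_fset bP E.
    by rewrite -(sigmaK a aP) E sigmaK.
  move=> v; apply/mapP/idP => [[a /sV + ->]//|vV]; exists (sigma v); first exact: sV.
  by rewrite sigmaK //; apply/mem_vertex_fset.
apply/eqP; rewrite eq_sym -subr_eq0 -sumrB -/(\sum_(v <- _) jump v).
(* Reindexing by the involution [sigma] turns the sum into its opposite. *)
have E : \sum_(v <- vertex_fset) jump v = - \sum_(v <- vertex_fset) jump v.
  rewrite -{1}(perm_big _ perm_sigma) big_map -sumrN big_seq [RHS]big_seq.
  by apply: eq_bigr => v /mem_vertex_fset/jump_sigma.
by apply/eqP; move: E; set S := bigop _ _ _; lia.
Qed.

End WallCrossing.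

(** * Moving along a segment of functionals *)

Section Paths.
Context (x xi0 xi1 : 'rV[R]_d) (xi0_gen : generic xi0) (xi1_gen : generic xi1).
(* This makes the walls met at a common time of the segment parallel. *)
Context (xi1_transversal : forall p q p' q',
  p \in V -> q \in V -> p' \in V -> q' \in V ->
  let n := dot xi0 (p - q) *: (p' - q') - dot xi0 (p' - q') *: (p - q) in
  n != 0 -> dot xi1 n != 0).

Let path (t : R) : 'rV[R]_d := xi0 + t *: (xi1 - xi0).

(** The zero of an affine function of time. With a vanishing denominator the quotient is 0 by
    convention, a spurious time that does no harm: [times] only has to contain all zeros. *)
Let crossing_time p q : R := dot xi0 (p - q) / (dot xi0 (p - q) - dot xi1 (p - q)).

Let times : seq R := [seq crossing_time p q | p <- V, q <- V].

Let pathE t p : dot (path t) p = dot xi0 p + t * (dot xi1 p - dot xi0 p).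
Proof. by rewrite dotDl dotZl dotBl. Qed.

Let path_zero t p q : p \in V -> q \in V -> p != q -> dot (path t) (p - q) = 0 ->
  t \in times.
Proof.
move=> pV qV pq; rewrite pathE => E.
have -> : t = crossing_time p q; last by apply/allpairsP; exists (p, q).
rewrite /crossing_time.
have := xi0_gen pV qV pq; move: (dot xi0 _) (dot xi1 _) E => a b E a0.
have ab : a - b != 0.
  apply: contraNneq a0 => ab; move: E.
  by rewrite -[b - a]opprB ab oppr0 mulr0 addr0 => ->.
have E' : t * (a - b) = a by rewrite -opprB mulrN in E; lra.
by rewrite -{1}E' mulfK.
Qed.

Let path_generic t : t \notin times -> generic (path t).
Proof.
move=> tT p q pV qV pq; apply: contra tT => /eqP.
exact: path_zero.
Qed.

Lemma notin_between (s : seq R) (a b : R) : a < b ->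
  exists2 r, a < r < b & r \notin s.
Proof.
elim: s a b => [|c s IHs] a b ab.
  by exists ((a + b) / 2); rewrite ?midf_lt.
have [m1 m2] := midf_lt ab; set m := (a + b) / 2 in m1 m2.
have [cm|mc] := leP c m.
  have [r /andP[mr rb] rs] := IHs m b m2; exists r; first by rewrite (lt_trans m1 mr).
  by rewrite inE negb_or rs gt_eqF // (le_lt_trans cm).
have [r /andP[ar rm] rs] := IHs a m m1; exists r; first by rewrite ar (lt_trans rm).
by rewrite inE negb_or rs lt_eqF // (lt_trans rm).
Qed.

Let single_crossing s t z : s < z < t -> generic (path s) -> generic (path t) ->
    (forall r, r \in times -> s < r < t -> r = z) ->
  cone_count x (path s) = cone_count x (path t).
Proof.
move=> /andP[sz zt] s_gen t_gen z_only.
(* The measuring functional [eta] is [xi0]. *)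
apply: (@wall_crossing x (path s) (path t) (path z) xi0) => //.
- move=> p q pV qV zpq; have pq : p != q.
    by apply: contraTneq zpq => ->; rewrite subrr dot0r ltxx.
  have no_zero r : dot (path r) (p - q) = 0 -> r \in times := path_zero pV qV pq.
  have := pathE^~ (p - q); set b := dot xi1 _ - _; set a := dot xi0 _ => gE.
  have {}no_zero r : a + r * b = 0 -> s < r < t -> r = z.
    by rewrite -gE => /no_zero; apply: z_only.
  have := s_gen p q pV qV pq; have := t_gen p q pV qV pq; move: zpq.
  rewrite !gE; move: (a) (b) no_zero {gE} => {}a {}b no_zero z_gt0 t0 s0; split.
  (* A negative value at [s] would give a zero [- a / b] between [s] and [t]. That zero would have
     to be [z], where the value is positive. *)
  + rewrite lt_neqAle eq_sym s0 /= leNgt; apply/negP => neg.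
    have b0 : 0 < b by nra.
    have := no_zero (- a / b); rewrite divfK ?gt_eqF // subrr.
    rewrite ltr_pdivlMr // ltr_pdivrMr // => /(_ erefl) H.
    have /H ab : (s * b < - a) && (- a < t * b) by apply/andP; split; nra.
    by move: z_gt0; rewrite -ab divfK ?gt_eqF // subrr ltxx.
  rewrite lt_neqAle eq_sym t0 /= leNgt; apply/negP => neg.
  have b0 : b < 0 by nra.
  have := no_zero (- a / b); rewrite divfK ?lt_eqF // subrr.
  rewrite ltr_ndivlMr // ltr_ndivrMr // => /(_ erefl) H.
  have /H ab : (- a < s * b) && (t * b < - a) by apply/andP; split; nra.
  by move: z_gt0; rewrite -ab divfK ?lt_eqF // subrr ltxx.
(* If both chords vanish at [z], then [xi1] kills the combination in [xi1_transversal], so that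
   combination is 0; this is the required proportionality. *)
move=> p q p' q' pV qV p'V q'V; rewrite !pathE => E E'.
apply/eqP; rewrite -subr_eq0; apply: contraT => /(xi1_transversal pV qV p'V q'V).
rewrite (dotBr xi1 (_ *: _)) !dotZr.
move: (dot xi0 _) (dot xi1 _) (dot xi0 _) (dot xi1 _) E E'.
move=> a' b' a b E E'; case/negP; apply/eqP.
have -> : a * b' - a' * b = (b' - a') * (a + z * (b - a)) + (a - b) * (a' + z * (b' - a')).
  by ring.
by rewrite E E' !mulr0 addr0.
Qed.

(** Induction on the number of crossing times inside. Two distinct ones are separated by a generic
    time, and each half then misses one of them. *)
Let path_constant s t : s < t -> generic (path s) -> generic (path t) ->
  cone_count x (path s) = cone_count x (path t).
Proof.
have [n] := ubnP (count (fun r => s < r < t) times).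
elim: n s t => // n IHn s t; rewrite ltnS => cn st s_gen t_gen.
have count_lt a b z : s <= a -> b <= t -> z \in times -> s < z < t -> ~~ (a < z < b) ->
    (count (fun r => a < r < b)%R times < n)%N.
  move=> sa bt zT zst zab; apply: leq_trans cn.
  have [k ->] : exists k, times = k ++ z :: drop (index z times).+1 times.
    exists (take (index z times) times).
    by rewrite -{2}(nth_index 0 zT) -drop_nth ?index_mem // cat_take_drop.
  have sub : subpred (fun r => a < r < b) (fun r => s < r < t).
    by move=> r /andP[ar rb]; rewrite (le_lt_trans sa) // (lt_le_trans rb).
  rewrite !count_cat /= zst (negbTE zab) add0n add1n addnS ltnS.
  by rewrite leq_add // sub_count.
have [[z [z' [zT z'T /andP[sz zz'] z't]]]|single] :=
  pselect (exists z z', [/\ z \in times, z' \in times, s < z < z' & z' < t]).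
  have [r /andP[zr rz'] rT] := notin_between times zz'.
  have r_gen := path_generic rT.
  have sr := lt_trans sz zr; have rt := lt_trans rz' z't.
  rewrite (IHn s r) //; first apply: (IHn r t) => //.
    apply: (count_lt _ _ z) => //; first exact: ltW.
      by rewrite sz (lt_trans zr).
    by rewrite negb_and -leNgt ltW.
  apply: (count_lt _ _ z') => //; first exact: ltW.
    by rewrite z't (lt_trans sr).
  by rewrite negb_and -!leNgt (ltW rz') orbT.
have [[z zT zst]|none] := pselect (exists2 z, z \in times & s < z < t).
  apply: (single_crossing zst) => // r rT /andP[sr rt]; apply/eqP.
  case/andP: zst => sz zt.
  have [rz|zr|//] := ltgtP r z; case: single.
    by exists r, z; rewrite sr rz.
  by exists z, r; rewrite sz zr.
(* Without a crossing time the midpoint stands in for the wall. *)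
apply: (single_crossing (z := (s + t) / 2)) => // [|r rT rst].
  by rewrite !midf_lt.
by case: none; exists r.
Qed.

Lemma cone_count_path : cone_count x xi0 = cone_count x xi1.
Proof.
have p0 : path 0 = xi0 by rewrite /path scale0r addr0.
have p1 : path 1 = xi1 by rewrite /path scale1r addrC subrK.
by rewrite -p0 -p1; apply: path_constant; rewrite ?p0 ?p1 // ltr01.
Qed.

End Paths.

(** * The count inside and outside the polytope *)

Lemma generic_minimizer xi : generic xi -> V != fset0 ->
  exists2 v, is_vertex P v & forall p, p \in V -> p != v -> 0 < dot xi (p - v).
Proof.
move=> xi_gen /fset0Pn[p0 p0V].
have [v vV vmax] := seq_argmax (fun p => - dot xi p) p0V.
have v_min p : p \in V -> p != v -> 0 < dot xi (p - v).
  move=> pV pv; rewrite lt_neqAle eq_sym xi_gen //= dotBr subr_ge0 -lerN2.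
  exact: vmax.
by exists v => //; apply: exposed_vertex v_min.
Qed.

Lemma polytope_V_neq0 : V != fset0.
Proof.
have [x0 [U [_ affP]]] := P_dim; apply/eqP => V0.
have : aff_hull P x0 by rewrite affP /= subrr mem0v.
move=> [n [p [a [Pp a1 _]]]].
case: n p a Pp a1 => [p a _|n p a Pp _].
  by rewrite big_ord0 => /esym/eqP; rewrite oner_eq0.
have [m [p' [a' [Vp' _ a1 _]]]] := Pp ord0.
case: m p' a' Vp' a1 => [p' a' _|m p' a' Vp' _].
  by rewrite big_ord0 => /esym/eqP; rewrite oner_eq0.
by have := Vp' ord0; rewrite V0.
Qed.

(** All coordinates of [x] are nonnegative, so a term is 1 exactly when every edge at [v] ascends.
    As edges generate the tangent cone, such a [v] minimizes [xi]. *)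
Lemma cone_count_inside x xi : generic xi -> P x -> cone_count x xi = 1.
Proof.
move=> xi_gen Px.
have termE v : is_vertex P v -> cone_term x v xi = [forall i, 0 < dot xi (W v i)]%:R.
  move=> vP; rewrite /cone_term /cone_factor.
  under eq_bigr do rewrite (le_gtF (polytope_coord_ge0 _ vP Px)) subr0.
  case: forallP => [all_pos|/forallP/forallPn[i /negbTE neg]].
    by apply: big1 => i _; rewrite all_pos.
  by rewrite (bigD1 i) //= neg mul0r.
have [v0 v0P v0_min] := generic_minimizer xi_gen polytope_V_neq0.
have v0V : v0 \in vertex_fset by apply/mem_vertex_fset.
rewrite /cone_count (big_fsetD1 v0) //= big_seq big1 ?addr0 => [|v].
  rewrite termE //; case: forallP => // -[] i.
  have [u [t [uP t0 uv ->]]] := edge_vector_chord i v0P.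
  by rewrite dotZr mulr_gt0 // v0_min // vertex_V.
rewrite in_fsetD1 => /andP[vv0 /mem_vertex_fset vP]; rewrite termE //.
case: forallP => // pos; have v0P' := vertex_in v0P.
have := edges_span_tangent_cone vP (w_edges vP) v0P'.
have : 0 < dot xi (v - v0) by apply: v0_min => //; apply: vertex_V.
rewrite -opprB dotNr oppr_gt0 ltNge => /negP neg cone_v; case: neg.
by apply: cone_dot_ge0 cone_v => _ [i _ <-]; apply/ltW/pos.
Qed.

(** If all factors are nonzero, each coordinate of [x - v] has the sign of [xi] on its edge vector.
    Then [dot xi (x - v)] is nonnegative, against separation. *)
Lemma cone_count_separated x xi : (forall p, p \in V -> 0 < dot xi (p - x)) ->
  cone_count x xi = 0.
Proof.
move=> sep; rewrite /cone_count big_seq big1 // => v /mem_vertex_fset vP.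
apply/eqP; apply: contraT => /prodf_neq0 factors.
have := sep v (vertex_V vP); rewrite -opprB dotNr oppr_gt0 ltNge => /negP[].
rewrite [x - v](coord_decomp _ (frameW vP)) dot_sumr; apply: sumr_ge0 => i _.
rewrite dotZr; have := factors i isT; rewrite /cone_factor.
case: ltP => [xi0|xi0]; case: ltP => [c0|c0] //= _.
  by rewrite mulr_ge0 // ltW.
by rewrite mulr_le0 // ltW.
Qed.

Theorem lawrence_varchenko x xi : generic xi ->
  cone_count x xi = (`[< P x >])%:R.
Proof.
move=> xi_gen; case: asboolP => [|Px]; first exact: cone_count_inside.
have [l lV] := conv_hull_separation Px.
pose chords := [seq p - q | p <- V, q <- V].
(* The vectors that [xi1_transversal] is about. Separation is an open condition, so [l] can be
   perturbed to avoid their hyperplanes as well as those of the chords. *)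
pose planes := [seq dot xi u *: u' - dot xi u' *: u | u <- chords, u' <- chords].
have chordV p q : p \in V -> q \in V -> p - q \in chords.
  by move=> pV qV; apply/allpairsP; exists (p, q).
have [|l' l'V l'_gen] :=
  @generic_functional _ _ [seq p - x | p <- V] (chords ++ planes) l.
  by move=> _ /mapP[p pV ->]; apply: lV.
rewrite (@cone_count_path x xi l') //.
- by apply: cone_count_separated => p pV; apply: l'V; apply: map_f.
- move=> p q pV qV pq; apply: l'_gen; last by rewrite subr_eq0.
  by rewrite mem_cat chordV.
move=> p q p' q' pV qV p'V q'V n; apply: l'_gen; rewrite mem_cat orbC.
by apply/orP; left; apply/allpairsP; exists (p - q, p' - q'); rewrite !chordV.
Qed.

Lemma generic_exists : exists xi, generic xi.
Proof.
have [//|xi _ xi_gen] := @generic_functional _ _ [::]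
  [seq p - q | p <- V, q <- V] (0 : 'rV[R]_d).
exists xi => p q pV qV pq; apply: xi_gen; last by rewrite subr_eq0.
by apply/allpairsP; exists (p, q).
Qed.

Lemma signed_sector x v xi : is_vertex P v -> generic xi ->
  cone_term x v xi =
  (-1) ^+ #|Eminus (w v) xi| * `[< sector (w v) v (Eminus (w v) xi) x >]%:R.
Proof.
move=> vP xi_gen.
have EminusE i : (i \in Eminus (w v) xi) = ~~ (0 < dot xi (W v i)).
  rewrite inE -/(edge_vectors (w v) i) dotC -/(W v).
  have [u [t [uP t0 uv ->]]] := edge_vector_chord i vP.
  have := xi_gen _ _ (vertex_V uP) (vertex_V vP) uv.
  by rewrite dotZr pmulr_rlt0 // pmulr_rgt0 //; case: ltgtP.
case: asboolP => [xS|xS].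
  rewrite mulr1 -sum1_card /cone_term.
  rewrite (eq_bigr (fun i => if i \in Eminus (w v) xi then -1 else 1)).
    by rewrite -big_mkcond prodr_const sum1_card.
  by move=> i _; rewrite /cone_factor -xS EminusE; case: (0 < _).
have [i xi_i] : exists i, (i \in Eminus (w v) xi) != (coord (W v) i (x - v) < 0).
  apply: contrapT => /forallNP xS'; apply: xS => i.
  by have /negP := xS' i; rewrite negbK => /eqP.
rewrite mulr0 /cone_term (bigD1 i) //= /cone_factor; move: xi_i; rewrite EminusE.
by case: (0 < _); case: (_ < 0) => //= _; rewrite ?subrr ?subr0 mul0r.
Qed.

End LawrenceVarchenko.

(** * From indicator functions to rational functions *)

Section LatticeSeries.
Context {R : realType} {d : nat}.
Implicit Types (A P : set 'rV[R]_d) (v x xi : 'rV[R]_d) (m n : 'rV[int]_d).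
Implicit Types (S T : {set 'I_d}).

Lemma toRB m n : toR (m - n) = toR m - toR n :> 'rV[R]_d.
Proof. by apply/rowP => i; rewrite !mxE intrB. Qed.

Lemma lattice_seriesE A n : lattice_series A n = (`[< A (toR n) >])%:R.
Proof.
by rewrite /lattice_series; congr (nat_of_bool _)%:R; apply/idP/asboolP; rewrite in_setE.
Qed.

Lemma finite_lattice_points A (b : R) : (forall x i, A x -> `|x 0 i| <= b) ->
  finite_set (lattice_points A).
Proof.
move=> Ab; pose M := Num.bound b.
have M_ub m i : lattice_points A m -> (`|m 0 i| < M%:Z)%R.
  move=> mA; rewrite -(ltr_int R) intr_norm; apply: (@le_lt_trans _ _ b).
    by have := Ab _ i mA; rewrite mxE.
  by apply: archi_boundP; apply: le_trans (Ab _ i mA).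
pose f (k : 'rV['I_(M + M).+1]_d) : 'rV[int]_d :=
  map_mx (fun j : 'I__ => (j : nat)%:Z - M%:Z) k.
apply: (@sub_finite_set _ _ (f @` setT)); last first.
  exact/finite_image/finite_finset.
move=> m mA; exists (\row_i inord (absz (m 0%R i + M%:Z))) => //.
apply/rowP => i; rewrite !mxE; have := M_ub m i mA => mM.
by rewrite inordK; lia.
Qed.

Context (w : 'I_d -> 'rV[int]_d) (v : 'rV[R]_d).
Let W : 'I_d -> 'rV[R]_d := edge_vectors w.
Context (W_unit : frame W \in unitmx).

Let w_neq0 i : w i != 0.
Proof.
apply: contraNneq (frame_neq0 i W_unit) => wi; rewrite /W /edge_vectors wi.
by apply/eqP/rowP => j; rewrite !mxE.
Qed.

Let coord_shift i k n :
  coord W k (toR (n - w i) - v) = coord W k (toR n - v) - (k == i)%:R.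
Proof. by rewrite toRB addrAC [LHS]coordB -[toR (w i)]/(W i) coord_base. Qed.

(* The cone truncated to a half-open box in the directions of [T]:
   multiplying by [1 - x^(w i)] adds [i] to [T]. *)
Let truncated T : set 'rV[R]_d := [set x | forall i,
  0 <= coord W i (x - v) /\ (i \in T -> coord W i (x - v) < 1)].

(** Induction on the number of directions not yet truncated. With all truncated, the set is a
    half-open parallelepiped, bounded and so with finitely many lattice points. *)
Let truncated_represented T : exists r, represents (lattice_series (truncated T)) r.
Proof.
have [n] := ubnP #|~: T|; elim: n T => // n IHn T; rewrite ltnS => Tn.
have [/existsP[i iT]|/existsPn T_full] := boolP [exists i, i \notin T].
  have [|r Tr] := IHn (i |: T).
    rewrite (leq_trans _ Tn) // proper_card //; apply/fintype.properP; split.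
      by apply/fintype.subsetP => k; rewrite !inE negb_or => /andP[].
    by exists i; rewrite !inE ?iT // eqxx.
  exists (r / laurent_eval (laurent_sub1 (w i))); apply: represents_divl.
    exact: laurent_sub1_neq0.
  rewrite (_ : laurent_mul _ _ = lattice_series (truncated (i |: T))) //.
  apply/funext => m; rewrite laurent_mul_sub1 // !lattice_seriesE.
  (* If a condition in another direction fails, all three indicators vanish, as shifting by [w i]
     changes coordinate [i] alone. *)
  have [Q|nQ] := pselect (forall k, k != i ->
    0 <= coord W k (toR m - v) /\ (k \in T -> coord W k (toR m - v) < 1)); last first.
    rewrite !asboolF ?subrr // => H; apply: nQ => k ki; have := H k;
      by rewrite ?in_setU1 ?coord_shift ?(negbTE ki) ?subr0.
  set y := coord W i (toR m - v).
  have -> : `[< truncated T (toR m) >] = (0 <= y).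
    apply/asboolP/idP => [/(_ i)[]//|y0 k].
    by have [->|/Q//] := eqVneq k i; rewrite (negbTE iT).
  have -> : `[< truncated T (toR (m - w i)) >] = (1 <= y).
    apply/asboolP/idP => [/(_ i)[]|y1 k].
      by rewrite coord_shift eqxx subr_ge0.
    rewrite coord_shift; have [->|/Q] := eqVneq k i; last by rewrite subr0.
    by rewrite subr_ge0 (negbTE iT).
  have -> : `[< truncated (i |: T) (toR m) >] = (0 <= y < 1).
    apply/asboolP/idP => [/(_ i)[-> /=]|/andP[y0 y1] k]; first by apply; rewrite setU11.
    by have [->//|ki] := eqVneq k i; rewrite in_setU1 (negbTE ki); apply: Q.
  have [y0|y0] := leP 0 y; have [y1|y1] := leP 1 y; rewrite /= ?subrr ?subr0 //.
  by have := lt_le_trans y0 (le_trans ler01 y1); rewrite ltxx.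
pose b := \sum_i (`|v 0 i| + \sum_k `|W k 0 i|).
have fin : finite_set (lattice_points (truncated T)).
  apply: (@finite_lattice_points _ b) => x i xT.
  apply: (@le_trans _ _ (`|v 0 i| + \sum_k `|W k 0 i|)); last first.
    rewrite /b [leRHS](bigD1 i) //= lerDl sumr_ge0 // => k _.
    by rewrite addr_ge0 // sumr_ge0.
  have -> : x = v + \sum_k coord W k (x - v) *: W k.
    by rewrite -coord_decomp // addrC subrK.
  rewrite mxE summxE; apply: le_trans (ler_normD _ _) _; rewrite lerD2l.
  apply: le_trans (ler_norm_sum _ _ _) _; apply: ler_sum => k _.
  have [c0] := xT k; have := T_full k; rewrite negbK => -> /(_ isT) c1.
  by rewrite mxE normrM ler_piMl // ger0_norm // ltW.
pose D := fset_set (lattice_points (truncated T)).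
exists (\sum_(n <- D) lconst (lattice_series (truncated T) n) * xmon n).
apply: represents_finite => m; rewrite in_fset_set //.
by rewrite /lattice_series => /negbTE ->.
Qed.

(** One [r], that of the closed cone, serves every [S]. The sectors of [S] and [S :\ i] are
    disjoint, and their union leaves coordinate [i] free, so it is invariant under [w i] and its
    series represents 0. *)
Lemma sector_represented : exists r, forall S,
  represents (lattice_series (sector w v S)) ((-1) ^+ #|S| * r).
Proof.
have [r r0] := truncated_represented finset.set0; exists r => S.
have [n] := ubnP #|S|; elim: n S => // n IHn S; rewrite ltnS => Sn.
have [->|[i iS]] := set_0Vmem S.
  rewrite cards0 mul1r (_ : sector w v finset.set0 = truncated finset.set0) //.
  apply/seteqP; split=> x xS i; have := xS i; rewrite finset.in_set0 leNgt.
    by move=> <-.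
  by case=> /negbTE ->.
have cardS : #|S| = #|S :\ i|.+1 by rewrite (cardsD1 i) iS.
have {}IHn := IHn (S :\ i); rewrite -cardS in IHn; have {IHn Sn} Sr := IHn Sn.
pose L n := lattice_series (sector w v S) n + lattice_series (sector w v (S :\ i)) n.
have L0 : represents L 0.
  apply: (represents_periodic (w_neq0 i)) => m; rewrite /L !lattice_seriesE.
  have [Q|nQ] := pselect (forall k, k != i ->
    (k \in S) = (coord W k (toR m - v) < 0)); last first.
    rewrite !asboolF // => H; apply: nQ => k ki; have := H k; rewrite ?in_setD1 ?ki //.
      by rewrite -/W coord_shift (negbTE ki) subr0.
    by rewrite -/W coord_shift (negbTE ki) subr0.
  have inS z : (forall k, k != i -> coord W k (z - v) = coord W k (toR m - v)) ->
      `[< sector w v S z >] = (coord W i (z - v) < 0).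
    move=> zm; apply/asboolP/idP => [/(_ i)|zi k]; first by rewrite iS => <-.
    by have [->|ki] := eqVneq k i; [rewrite iS zi|rewrite -/W zm // Q].
  have inSi z : (forall k, k != i -> coord W k (z - v) = coord W k (toR m - v)) ->
      `[< sector w v (S :\ i) z >] = (0 <= coord W i (z - v)).
    move=> zm; apply/asboolP/idP => [/(_ i)|zi k]; first by rewrite setD11 leNgt => <-.
    have [->|ki] := eqVneq k i; first by rewrite setD11 ltNge zi.
    by rewrite in_setD1 ki -/W zm // Q.
  have shift k : k != i -> coord W k (toR (m - w i) - v) = coord W k (toR m - v).
    by move=> ki; rewrite coord_shift (negbTE ki) subr0.
  rewrite !inS // !inSi //.
  by case: ltP => _; case: ltP => _; rewrite /= ?addr0 ?add0r.
have := representsD L0 (representsZ (-1) Sr).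
rewrite add0r cardS exprS -mulrA.
rewrite (_ : lconst (-1) = -1); last first.
  by rewrite /lconst mpolyCN mpolyC1 tofracN tofrac1.
rewrite (_ : (fun n => _) = lattice_series (sector w v S)) //.
by apply/funext => m; rewrite mulN1r /L addrK.
Qed.

End LatticeSeries.

(** * The identity of rational functions *)

Theorem mainTheorem1 (R : realType) (d : nat) (P : set 'rV[R]_d)
    (P_polytope : is_polytope P) (P_dim : has_dim P d) (P_simple : is_simple P)
    (P_rational : forall F : set 'rV[R]_d, is_edge P F -> rational_direction F)
    (w : 'rV[R]_d -> 'I_d -> 'rV[int]_d)
    (w_edges : forall v : 'rV[R]_d, is_vertex P v -> edge_directions P v (w v))
    (xi : 'rV[R]_d -> 'rV[R]_d)
    (xi_generic : forall v : 'rV[R]_d, is_vertex P v ->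
       forall i : 'I_d, dot (toR (w v i)) (xi v) <> 0) :
  sigma_polytope P =
  \sum_(v \in [set v : 'rV[R]_d | is_vertex P v])
     (-1) ^+ #|Eminus (w v) (xi v)| *
     sigma_cone (half_open_cone (w v) (xi v) v).
Proof.
have [V0 /finite_fsetP[V ->] PV] := P_polytope; subst P.
have W_unit v (vP : is_vertex (conv_hull [set` V]) v) := frameW P_dim w_edges vP.
have r_ex v : exists rv : ratfun R[i] d,
    is_vertex (conv_hull [set` V]) v -> forall S : {set 'I_d},
    represents (lattice_series (sector (w v) v S)) ((-1) ^+ #|S| * rv).
  have [vP|nvP] := pselect (is_vertex (conv_hull [set` V]) v); last by exists 0.
  by have [rv ?] := sector_represented v (W_unit v vP); exists rv.
have [r r_spec] := choice r_ex.
have vertices : [set v | is_vertex (conv_hull [set` V]) v] = [set` vertex_fset V].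
  by apply/seteqP; split=> v /mem_vertex_fset.
(* The sign in front and the sign from [sector_represented] multiply to 1, so each summand is [r v]
   whatever [xi v] is. *)
have -> : \sum_(v \in [set v | is_vertex (conv_hull [set` V]) v])
     (-1) ^+ #|Eminus (w v) (xi v)| *
     sigma_cone (half_open_cone (w v) (xi v) v) = \sum_(v <- vertex_fset V) r v.
  rewrite vertices fsbig_finite // set_fsetK big_seq [RHS]big_seq.
  apply: eq_bigr => v /mem_vertex_fset vP.
  rewrite half_open_coneE ?W_unit // => [|i]; last exact/eqP/xi_generic.
  rewrite /sigma_cone (ratfun_of_seriesE (r_spec v vP _)).
  by rewrite mulrA -exprMn mulrNN mulr1 expr1n mul1r.
have [xi0 xi0_gen] := generic_exists V.
pose S0 v := Eminus (w v) xi0.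
have seriesP : lattice_series (conv_hull [set` V]) = fun n =>
    \sum_(v <- vertex_fset V) (-1) ^+ #|S0 v| * lattice_series (sector (w v) v (S0 v)) n.
  apply/funext => n; rewrite lattice_seriesE.
  have := lawrence_varchenko P_dim P_rational w_edges (toR n) xi0_gen.
  move=> /(congr1 (fun z : int => z%:~R : R[i])); rewrite /= rmorph_nat => <-.
  rewrite /cone_count rmorph_sum /= big_seq [RHS]big_seq.
  apply: eq_bigr => v /mem_vertex_fset vP.
  rewrite (signed_sector P_dim P_rational w_edges) // lattice_seriesE.
  by rewrite rmorphM rmorphXn rmorphN1 rmorph_nat.
(* The indicator identity at [xi0], read coefficientwise, gives the same sum of the [r v];
   uniqueness then identifies it with the finite sum over the lattice points. *)
have lhs : represents (lattice_series (conv_hull [set` V])) (\sum_(v <- vertex_fset V) r v).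
  rewrite seriesP.
  have -> : \sum_(v <- vertex_fset V) r v =
      \sum_(v <- vertex_fset V) lconst ((-1) ^+ #|S0 v|) * ((-1) ^+ #|S0 v| * r v).
    apply: eq_bigr => v _; rewrite /lconst !rmorphXn !rmorphN1.
    by rewrite mulrA -exprMn mulrNN mulr1 expr1n mul1r.
  apply: represents_sum => v /mem_vertex_fset vP.
  exact/representsZ/r_spec.
apply: represents_uniq lhs.
have fin : finite_set (lattice_points (conv_hull [set` V])).
  apply: (@finite_lattice_points _ _ _ (\sum_(p <- V) \sum_i `|p 0 i|)) => x i.
  pose e : 'rV[R]_d := \row_k (k == i)%:R.
  have eE p : dot e p = p 0 i.
    rewrite /dot (bigD1 i) //= big1 ?addr0 => [|k /negbTE ki]; rewrite mxE ?ki ?mul0r //.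
    by rewrite eqxx mul1r.
  have pb p : [set` V] p -> `|p 0 i| <= \sum_(p <- V) \sum_i `|p 0 i|.
    move=> pV; rewrite (big_fsetD1 p) //= (bigD1 i) //= -addrA lerDl addr_ge0 //.
      by rewrite sumr_ge0.
    by rewrite sumr_ge0 // => q _; rewrite sumr_ge0.
  move=> xV; rewrite ler_norml lerNl -!eE -dotNl; apply/andP; split.
    apply: conv_hull_dot_ub xV => p /pb; rewrite dotNl eE.
    by apply: le_trans; rewrite -normrN ler_norm.
  by apply: conv_hull_dot_ub xV => p /pb; rewrite eE; apply: le_trans; rewrite ler_norm.
rewrite /sigma_polytope fsbig_finite //.
have inD n : (n \in fset_set (lattice_points (conv_hull [set` V]))) =
    (n \in lattice_points (conv_hull [set` V])) by rewrite in_fset_set.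
have := @represents_finite R[i] d (lattice_series (conv_hull [set` V]))
  (fset_set (lattice_points (conv_hull [set` V]))).
under eq_big_seq => n nD do rewrite /lattice_series -inD nD lconst1 mul1r.
by apply=> n; rewrite inD /lattice_series => /negbTE ->.
Qed.
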